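(* For all integers $n,r\geq1$ and $k\geq2$, the Brin-Higman-Thompson group $nV_{k,r}$ is C*-simple.
   Context: For $k\geq2$ let $X_k=\{1,\dots,k\}^{\mathbb{N}}$ with the shift $\sigma$, and let $\mathcal{E}_k=\{(x,m,y)\in X_k\times\mathbb{Z}\times X_k: \exists\,p,q\geq0,\ m=p-q,\ \sigma^p(x)=\sigma^q(y)\}$ with $(x,m,y)(y,m',z)=(x,m+m',z)$, $(x,m,y)^{-1}=(y,-m,x)$, and topology with basis the sets $\{(\mu z,|\mu|-|\nu|,\nu z): z\in U\}$ for finite words $\mu,\nu$ and open $U\subseteq X_k$; its unit space is identified with $X_k$. Let $\mathcal{R}_r$ be the full equivalence relation on $\{1,\dots,r\}$, as a discrete groupoid. For a topological groupoid $\mathcal{G}$ with source and range maps $s,r$ and compact unit space $\mathcal{G}^{(0)}$, the topological full group $\mathsf{F}(\mathcal{G})\leq\mathrm{Homeo}(\mathcal{G}^{(0)})$ consists of the homeomorphisms $r\circ(s|_B)^{-1}$, where $B\subseteq\mathcal{G}$ is a compact open set such that $s|_B$ and $r|_B$ are homeomorphisms onto $\mathcal{G}^{(0)}$. The Brin-Higman-Thompson group is $nV_{k,r}=\mathsf{F}(\mathcal{R}_r\times\mathcal{E}_k^n)$. A discrete group $H$ is C*-simple if its reduced group C*-algebra $C^*_r(H)$ is simple. *)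

(* Defs.v *)
From HB Require Import structures.
From mathcomp Require Import all_boot all_order all_algebra complex.
From mathcomp Require Import all_classical all_reals all_analysis.
From mathcomp Require Import zify ring lra.

Set Implicit Arguments.
Unset Strict Implicit.
Unset Printing Implicit Defensive.

Import Order.TTheory GRing.Theory Num.Theory.
Import numFieldNormedType.Exports.

Local Open Scope classical_set_scope.

Record homeo (X : topologicalType) := Homeo {
  homeo_fun :> X -> X;
  homeo_inv : X -> X;
  homeo_funK : cancel homeo_fun homeo_inv;
  homeo_invK : cancel homeo_inv homeo_fun;
  homeo_fun_cts : continuous homeo_fun;
  homeo_inv_cts : continuous homeo_inv }.

HB.instance Definition _ (X : topologicalType) := gen_eqMixin (homeo X).
HB.instance Definition _ (X : topologicalType) := gen_choiceMixin (homeo X).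

Section homeo_group.
Context (X : topologicalType).
Implicit Types f g h : homeo X.

Lemma homeo_eq f g : f =1 g -> f = g.
Proof.
case: f g => f f' fK f'K cf cf' [g g' gK g'K cg cg'] /= /funext fg; subst g.
have f'g' : f' = g' by apply/funext => x; rewrite -{1}(g'K x) fK.
by subst g'; congr Homeo; exact: Prop_irrelevance.
Qed.

Definition homeo_id : homeo X :=
  @Homeo X id id (fun=> erefl) (fun=> erefl) (fun x => cvg_id) (fun x => cvg_id).

Definition homeo_V f : homeo X :=
  Homeo (@homeo_invK X f) (@homeo_funK X f) (@homeo_inv_cts X f)
        (@homeo_fun_cts X f).

Lemma homeo_comp_cts (f g : X -> X) :
  continuous f -> continuous g -> continuous (f \o g).
Proof. by move=> cf cg x; apply: continuous_comp; [exact: cg|exact: cf]. Qed.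

Definition homeo_comp f g : homeo X :=
  Homeo (can_comp (@homeo_funK X f) (@homeo_funK X g))
        (can_comp (@homeo_invK X g) (@homeo_invK X f))
        (homeo_comp_cts (@homeo_fun_cts X f) (@homeo_fun_cts X g))
        (homeo_comp_cts (@homeo_inv_cts X g) (@homeo_inv_cts X f)).

Lemma homeo_compA : associative homeo_comp.
Proof. by move=> f g h; apply: homeo_eq. Qed.
Lemma homeo_comp1 : left_id homeo_id homeo_comp.
Proof. by move=> f; apply: homeo_eq. Qed.
Lemma homeo_1comp : right_id homeo_id homeo_comp.
Proof. by move=> f; apply: homeo_eq. Qed.
Lemma homeo_compV : left_inverse homeo_id homeo_V homeo_comp.
Proof. by move=> f; apply: homeo_eq => x /=; rewrite homeo_funK. Qed.
Lemma homeo_Vcomp : right_inverse homeo_id homeo_V homeo_comp.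
Proof. by move=> f; apply: homeo_eq => x /=; rewrite homeo_invK. Qed.

HB.instance Definition _ := isGroup.Build (homeo X)
  homeo_compA homeo_comp1 homeo_1comp homeo_compV homeo_Vcomp.

End homeo_group.

(* The unit space is a separate type embedded in the arrows by gid, which is a
   homeomorphism onto its image since src is a continuous retraction of it.
   gmul is total; only its values on pairs with src g = rng h are meaningful,
   and its continuity is required on the subspace of those pairs only. *)
Record topGroupoid := TopGroupoid {
  arrow :> topologicalType;
  unit_space : topologicalType;
  src : arrow -> unit_space;
  rng : arrow -> unit_space;
  gid : unit_space -> arrow;
  ginv : arrow -> arrow;
  gmul : arrow -> arrow -> arrow;
  src_gid : forall x, src (gid x) = x;
  rng_gid : forall x, rng (gid x) = x;
  src_ginv : forall g, src (ginv g) = rng g;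
  rng_ginv : forall g, rng (ginv g) = src g;
  src_gmul : forall g h, src g = rng h -> src (gmul g h) = src h;
  rng_gmul : forall g h, src g = rng h -> rng (gmul g h) = rng g;
  gmulA : forall g h k, src g = rng h -> src h = rng k ->
    gmul g (gmul h k) = gmul (gmul g h) k;
  gmul1g : forall g, gmul (gid (rng g)) g = g;
  gmulg1 : forall g, gmul g (gid (src g)) = g;
  gmulVg : forall g, gmul (ginv g) g = gid (src g);
  gmulgV : forall g, gmul g (ginv g) = gid (rng g);
  src_cts : continuous src;
  rng_cts : continuous rng;
  gid_cts : continuous gid;
  ginv_cts : continuous ginv;
  gmul_cts : {within [set p : arrow * arrow | src p.1 = rng p.2],
    continuous (fun p => gmul p.1 p.2)} }.

Arguments src {t}.
Arguments rng {t}.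
Arguments gid {t}.
Arguments ginv {t}.
Arguments gmul {t}.

Lemma gmul_ctsP (Y X : topologicalType) (s r : Y -> X) (m : Y -> Y -> Y) :
  {within [set p : Y * Y | s p.1 = r p.2], continuous (fun p => m p.1 p.2)} <->
  (forall g h, s g = r h -> forall U, nbhs (m g h) U -> exists V W,
     [/\ nbhs g V, nbhs h W &
       forall g' h', V g' -> W h' -> s g' = r h' -> U (m g' h')]).
Proof.
split=> [/subspace_continuousP c|c]; [move=> g h gh U Ugh|].
  have [[V W] /= [gV hW] VW] := c (g, h) gh U Ugh.
  by exists V, W; split=> // g' h' Vg Wh gh'; apply: (VW (g', h')).
apply/subspace_continuousP => -[g h] /= gh U /(c _ _ gh)[V [W [gV hW VW]]].
by exists (V, W) => // -[g' h'] [Vg Wh] gh'; exact: VW.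
Qed.

Lemma gmul_continuous (G : topGroupoid) (Z : topologicalType) (a b : Z -> G) :
  continuous a -> continuous b -> (forall z, src (a z) = rng (b z)) ->
  continuous (fun z => gmul (a z) (b z)).
Proof.
move=> ca cb ab z U.
have /gmul_ctsP/(_ _ _ (ab z) U) := @gmul_cts G.
move=> /[apply] -[V [W [aV bW VW]]]; have Ha := ca z V aV; have Hb := cb z W bW.
change (nbhs z (fun t => U (gmul (a t) (b t)))).
by apply: (@filterS2 _ _ _ (a @^-1` V) (b @^-1` W)) Ha Hb => t Va Wb; exact: VW.
Qed.

(* The restriction of f to B is a homeomorphism from B onto the whole of X; g is
   its inverse. *)
Definition homeo_onto (Y X : topologicalType) (B : set Y) (f : Y -> X) : Prop :=
  exists g : X -> Y, [/\ {within B, continuous f}, continuous g,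
    (forall x, B (g x)), cancel g f & forall b, B b -> g (f b) = b].

Section full_group.
Context (G : topGroupoid).

(* The equation h (src b) = rng b for b in B says h = rng \o (src|_B)^-1, since
   src maps B onto the unit space. *)
Definition full_group : set (homeo (unit_space G)) :=
  [set h | exists B : set G, [/\ compact B, open B,
     homeo_onto B src, homeo_onto B rng & forall b, B b -> h (src b) = rng b]].

Local Open Scope group_scope.

Lemma compact_img (Y X : topologicalType) (f : Y -> X) (A : set Y) :
  continuous f -> compact A -> compact (f @` A).
Proof.
by move=> cf; apply: continuous_compact; exact: continuous_subspaceT.
Qed.

Lemma full_groupV h : full_group h -> full_group h^-1.
Proof.
move=> [B [Bc Bo [s [_ sc Bs sK Ks]] [r [_ rc Br rK Kr]] hB]].
have invK g : ginv (ginv g) = g :> G.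
  rewrite -[LHS]gmulg1 src_ginv rng_ginv -gmulVg gmulA ?src_ginv ?rng_ginv//.
  by rewrite gmulVg src_ginv gmul1g.
exists (ginv @` B); split.
- by apply: compact_img => //; exact: ginv_cts.
- rewrite (_ : _ @` _ = ginv @^-1` B).
    by apply: open_comp => // x _; exact: ginv_cts.
  apply/seteqP; split=> [_ [b Bb <-]/=|g Bg]; first by rewrite invK.
  by exists (ginv g).
- exists (ginv \o r); split=> //=.
  + by apply: continuous_subspaceT; exact: src_cts.
  + by move=> x; apply: continuous_comp; [exact: rc|exact: ginv_cts].
  + by move=> x; exists (r x).
  + by move=> x /=; rewrite src_ginv rK.
  + by move=> _ [b Bb <-]; rewrite src_ginv Kr.
- exists (ginv \o s); split=> //=.
  + by apply: continuous_subspaceT; exact: rng_cts.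
  + by move=> x; apply: continuous_comp; [exact: sc|exact: ginv_cts].
  + by move=> x; exists (s x).
  + by move=> x /=; rewrite rng_ginv sK.
  + by move=> _ [b Bb <-]; rewrite rng_ginv Ks.
- move=> _ [b Bb <-]; rewrite src_ginv rng_ginv -(hB b Bb).
  by rewrite /inv/= homeo_funK.
Qed.

Lemma full_groupM h1 h2 : full_group h1 -> full_group h2 -> full_group (h1 * h2).
Proof.
move=> [B1 [_ _ [s1 [_ s1c Bs1 s1K Ks1]] [r1 [_ r1c Br1 r1K Kr1]] hB1]].
move=> [B2 [Bc2 Bo2 [s2 [_ s2c Bs2 s2K Ks2]] [r2 [_ r2c Br2 r2K Kr2]] hB2]].
have Xc : compact [set: unit_space G].
  rewrite (_ : setT = src @` B2); first by apply: compact_img => //; exact: src_cts.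
  by apply/seteqP; split=> // x _; exists (s2 x).
have rs2 x : rng (s2 x) = h2 x by rewrite -hB2// s2K.
pose th x := gmul (s1 (h2 x)) (s2 x).
have thc : continuous th.
  apply: gmul_continuous => // [|x]; last by rewrite s1K rs2.
  by move=> x; apply: continuous_comp; [exact: homeo_fun_cts|exact: s1c].
pose B : set G := [set g | exists b1 b2, [/\ B1 b1, B2 b2, src b1 = rng b2 &
  g = gmul b1 b2]].
have Bth x : B (th x).
  by exists (s1 (h2 x)), (s2 x); split=> //; rewrite s1K rs2.
have Kth b : B b -> th (src b) = b.
  move=> [b1 [b2 [B1b B2b b12 ->]]]; rewrite /th src_gmul// hB2// -b12.
  by rewrite Ks1// Ks2.
pose ph (g : G) := gmul (ginv (r1 (rng g))) g.
have phc : continuous ph.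
  apply: gmul_continuous => [g|g|g]; [|exact: cvg_id|by rewrite src_ginv r1K].
  apply: continuous_comp; last exact: ginv_cts.
  by apply: continuous_comp; [exact: rng_cts|exact: r1c].
pose rh x := gmul (r1 x) (r2 (src (r1 x))).
exists B; split.
- rewrite (_ : B = th @` setT); first exact: compact_img.
  apply/seteqP; split=> [b Bb|_ [x _ <-]//]; by exists (src b) => //; exact: Kth.
- rewrite (_ : B = ph @^-1` B2); first by apply: open_comp => // x _; exact: phc.
  apply/seteqP; split=> [_ [b1 [b2 [B1b B2b b12 ->]]]|g B2g].
    rewrite /ph/= rng_gmul// Kr1// gmulA ?src_ginv// gmulVg b12.
    by rewrite gmul1g.
  exists (r1 (rng g)), (ph g); split=> //.
    by rewrite rng_gmul ?rng_ginv// src_ginv r1K.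
  rewrite /ph gmulA ?rng_ginv// ?src_ginv ?r1K//.
  by rewrite gmulgV r1K gmul1g.
- exists th; split=> //.
  + by apply: continuous_subspaceT; exact: src_cts.
  + by move=> x; rewrite /th src_gmul// s1K rs2.
- exists rh; split.
  + by apply: continuous_subspaceT; exact: rng_cts.
  + apply: gmul_continuous => [//|x|x]; last by rewrite r2K.
    apply: continuous_comp; last exact: r2c.
    by apply: continuous_comp; [exact: r1c|exact: src_cts].
  + by move=> x; exists (r1 x), (r2 (src (r1 x))); split=> //; rewrite r2K.
  + by move=> x; rewrite /rh rng_gmul ?r2K.
  + move=> _ [b1 [b2 [B1b B2b b12 ->]]]; rewrite /rh rng_gmul// Kr1// b12.
    by rewrite Kr2.
- move=> _ [b1 [b2 [B1b B2b b12 ->]]]; rewrite src_gmul// rng_gmul//.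
  by rewrite /mul/= hB2// -b12 hB1.
Qed.

Lemma full_group1 : compact [set: unit_space G] -> open (range (@gid G)) ->
  full_group 1.
Proof.
move=> Gc Go; exists (range gid).
have gid_c := @gid_cts G.
split=> //; first exact: compact_img.
- exists gid; split=> //; first exact/continuous_subspaceT/src_cts.
    by move=> x; exact: src_gid.
  by move=> _ [x _ <-]; rewrite src_gid.
- exists gid; split=> //; first exact/continuous_subspaceT/rng_cts.
    by move=> x; exact: rng_gid.
  by move=> _ [x _ <-]; rewrite rng_gid.
- by move=> _ [x _ <-]; rewrite src_gid rng_gid.
Qed.

Definition in_full_group : {pred homeo (unit_space G)} :=
  fun h => `[< full_group h >].

Lemma full_group_closed : compact [set: unit_space G] ->
  open (range (@gid G)) -> group_closed in_full_group.
Proof.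
move=> Gc Go; split=> [|h1 h2 /asboolP F1 /asboolP F2]; apply/asboolP.
  exact: full_group1.
by apply: full_groupM => //; exact: full_groupV.
Qed.

End full_group.

(* The full group contains the identity only if the unit space is compact and
   open in the arrows; both are therefore needed for the group structure. *)
Record topological_full_group (G : topGroupoid)
    (Gc : compact [set: unit_space G]) (Go : open (range (@gid G))) := FullGroup {
  full_group_val :> homeo (unit_space G);
  full_group_valP : full_group_val \in @in_full_group G }.

Section full_group_instances.
Context (G : topGroupoid).
Context (Gc : compact [set: unit_space G]) (Go : open (range (@gid G))).
Local Notation F := (topological_full_group Gc Go).

HB.instance Definition _ := [isSub of F for @full_group_val G Gc Go].
HB.instance Definition _ := [Choice of F by <:].
HB.instance Definition _ :=
  SubChoice_isSubGroup.Build (homeo (unit_space G)) (@in_full_group G) F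
    (full_group_closed Gc Go).
End full_group_instances.

Section product_groupoid.
Context (G K : topGroupoid).
Local Notation A := (G * K)%type.
Local Notation X := (unit_space G * unit_space K)%type.
Definition prod_src (g : A) : X := (src g.1, src g.2).
Definition prod_rng (g : A) : X := (rng g.1, rng g.2).
Definition prod_gid (x : X) : A := (gid x.1, gid x.2).
Definition prod_ginv (g : A) : A := (ginv g.1, ginv g.2).
Definition prod_gmul (g h : A) : A := (gmul g.1 h.1, gmul g.2 h.2).

Let pair_cts (T1 T2 U1 U2 : topologicalType) (f : T1 -> U1) (g : T2 -> U2) :
  continuous f -> continuous g ->
  continuous (fun p : T1 * T2 => (f p.1, g p.2)).
Proof.
move=> cf cg -[x y] /= U [[V W] /= [Vx Wy] VW].
exists (f @^-1` V, g @^-1` W); first by split; [exact: cf|exact: cg].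
by move=> [a b] /= [Va Wb]; exact: VW.
Qed.

Let m_cts : {within [set p : A * A | prod_src p.1 = prod_rng p.2],
  continuous (fun p => prod_gmul p.1 p.2)}.
Proof.
apply/gmul_ctsP => -[g1 g2] [h1 h2] [e1 e2] U [[U1 U2] /= [n1 n2] UU].
have /gmul_ctsP/(_ _ _ e1 U1 n1)[V1 [W1 [gV1 hW1 VW1]]] := @gmul_cts G.
have /gmul_ctsP/(_ _ _ e2 U2 n2)[V2 [W2 [gV2 hW2 VW2]]] := @gmul_cts K.
exists (V1 `*` V2), (W1 `*` W2); split; [by exists (V1, V2)|by exists (W1, W2)|].
move=> [a1 a2] [b1 b2] [/= ? ?] [/= ? ?] [? ?]; apply: UU; split=> /=.
  exact: VW1.
exact: VW2.
Qed.

Definition prod_groupoid : topGroupoid.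
Proof.
refine (@TopGroupoid A X prod_src prod_rng prod_gid prod_ginv prod_gmul
  _ _ _ _ _ _ _ _ _ _ _ _ _ _ _ m_cts).
- by move=> [x y]; rewrite /prod_src/= !src_gid.
- by move=> [x y]; rewrite /prod_rng/= !rng_gid.
- by move=> [x y]; rewrite /prod_src/prod_rng/= !src_ginv.
- by move=> [x y]; rewrite /prod_src/prod_rng/= !rng_ginv.
- by move=> [g1 g2] [h1 h2] [/= ? ?]; rewrite /prod_src/= !src_gmul.
- by move=> [g1 g2] [h1 h2] [/= ? ?]; rewrite /prod_rng/= !rng_gmul.
- by move=> [g1 g2] [h1 h2] [k1 k2] [/= ? ?] [/= ? ?]; rewrite /prod_gmul/= !gmulA.
- by move=> [g1 g2]; rewrite /prod_gmul/= !gmul1g.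
- by move=> [g1 g2]; rewrite /prod_gmul/= !gmulg1.
- by move=> [g1 g2]; rewrite /prod_gmul/prod_gid/= !gmulVg.
- by move=> [g1 g2]; rewrite /prod_gmul/prod_gid/= !gmulgV.
- by apply: pair_cts; exact: src_cts.
- by apply: pair_cts; exact: rng_cts.
- by apply: pair_cts; exact: gid_cts.
- by apply: pair_cts; exact: ginv_cts.
Defined.

Lemma prod_unit_compact : compact [set: unit_space G] ->
  compact [set: unit_space K] -> compact [set: unit_space prod_groupoid].
Proof. by move=> Gc Kc; have := compact_setX Gc Kc; rewrite setXTT. Qed.

Lemma prod_units_open : open (range (@gid G)) -> open (range (@gid K)) ->
  open (range (@gid prod_groupoid)).
Proof.
rewrite !openE => Go Ko _ [[x y] _ <-].
exists (range (@gid G), range (@gid K)).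
  by split; [apply: Go; exists x|apply: Ko; exists y].
by move=> [_ _] /= [[a _ <-] [b _ <-]]; exists (a, b).
Qed.
End product_groupoid.

Section ptws_lemmas.

Lemma ptws_cvgP (J : eqType) (U : topologicalType)
    (F : set_system {ptws J -> U}) (f : {ptws J -> U}) : Filter F ->
  (forall j V, nbhs (f j) V -> F [set g | V (g j)]) -> F --> f.
Proof.
move=> FF H; apply/cvg_sup => j U0 [V [[W oW <-] Wf] WU].
apply: filterS WU _ => /=; apply: (H j W).
by apply: open_nbhs_nbhs.
Qed.

Lemma ptws_nbhs (J : eqType) (U : topologicalType) (f : {ptws J -> U}) j V :
  nbhs (f j) V -> nbhs f [set g : {ptws J -> U} | V (g j)].
Proof. by move=> fV; apply: (@proj_continuous J (fun=> U) j f). Qed.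

Lemma ptws_continuous (T : topologicalType) (J : eqType) (U : topologicalType)
    (f : T -> {ptws J -> U}) :
  (forall x j V, nbhs (f x j) V -> nbhs x [set y | V (f y j)]) -> continuous f.
Proof.
move=> H x; apply: ptws_cvgP => j V; exact: H.
Qed.

Lemma ptws_map_cts (J : eqType) (U W : topologicalType) (f : U -> W) :
  continuous f ->
  continuous (fun (x : {ptws J -> U}) => (fun j => f (x j)) : {ptws J -> W}).
Proof.
move=> cf; apply: ptws_continuous => x j V /cf xV.
exact: (@ptws_nbhs J U x j (f @^-1` V)).
Qed.

End ptws_lemmas.

Section power_groupoid.
Context (I : finType) (G : topGroupoid).
Local Notation A := {ptws I -> G}.
Local Notation X := {ptws I -> unit_space G}.
Definition pow_src (g : A) : X := fun j => src (g j).
Definition pow_rng (g : A) : X := fun j => rng (g j).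
Definition pow_gid (x : X) : A := fun j => gid (x j).
Definition pow_ginv (g : A) : A := fun j => ginv (g j).
Definition pow_gmul (g h : A) : A := fun j => gmul (g j) (h j).

Let m_cts : {within [set p : A * A | pow_src p.1 = pow_rng p.2],
  continuous (fun p => pow_gmul p.1 p.2)}.
Proof.
apply/subspace_continuousP => -[g h] /= gh; apply: ptws_cvgP => j V nV.
have ghj : src (g j) = rng (h j) := congr1 (@^~ j) gh.
have /gmul_ctsP/(_ _ _ ghj V nV)[V1 [W1 [gV1 hW1 VW1]]] := @gmul_cts G.
exists ([set g' : A | V1 (g' j)], [set g' : A | W1 (g' j)]).
  by split; exact: ptws_nbhs.
by move=> [g' h'] [/= ? ?] gh'; apply: VW1 => //; exact: (congr1 (@^~ j) (gh' : pow_src g' = pow_rng h')).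
Qed.

Definition pow_groupoid : topGroupoid.
Proof.
refine (@TopGroupoid A X pow_src pow_rng pow_gid pow_ginv pow_gmul
  _ _ _ _ _ _ _ _ _ _ _ _ _ _ _ m_cts).
- by move=> x; apply/funext => j; exact: src_gid.
- by move=> x; apply/funext => j; exact: rng_gid.
- by move=> x; apply/funext => j; exact: src_ginv.
- by move=> x; apply/funext => j; exact: rng_ginv.
- by move=> g h gh; apply/funext => j; exact: (@src_gmul G (g j) (h j) (congr1 (@^~ j) gh)).
- by move=> g h gh; apply/funext => j; exact: (@rng_gmul G (g j) (h j) (congr1 (@^~ j) gh)).
- move=> g h k gh hk; apply/funext => j.
  exact: (@gmulA G (g j) (h j) (k j) (congr1 (@^~ j) gh) (congr1 (@^~ j) hk)).
- by move=> x; apply/funext => j; exact: gmul1g.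
- by move=> x; apply/funext => j; exact: gmulg1.
- by move=> x; apply/funext => j; exact: gmulVg.
- by move=> x; apply/funext => j; exact: gmulgV.
- by apply: ptws_map_cts; exact: src_cts.
- by apply: ptws_map_cts; exact: rng_cts.
- by apply: ptws_map_cts; exact: gid_cts.
- by apply: ptws_map_cts; exact: ginv_cts.
Defined.

Lemma pow_unit_compact : compact [set: unit_space G] ->
  compact [set: unit_space pow_groupoid].
Proof.
move=> Gc; have := @tychonoff I (fun=> unit_space G) (fun=> setT) (fun=> Gc).
by congr (compact _); apply/seteqP; split.
Qed.

Lemma pow_units_open : open (range (@gid G)) ->
  open (range (@gid pow_groupoid)).
Proof.
rewrite !openE => Go _ [x _ <-].
pose y : A := pow_gid x.
have : nbhs y [set g : A | forall j, range (@gid G) (g j)].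
  apply: (@filter_forall _ _ (fun j => [set g : A | range (@gid G) (g j)]) _
    (@nbhs_filter A y)) => j.
  by apply: (@ptws_nbhs I G y j (range (@gid G))); apply: Go; exists (x j).
apply: filterS => g gr; exists (pow_src g) => //; apply/funext => j.
by have [z _ zE] := gr j; rewrite /= /pow_gid /pow_src -zE src_gid.
Qed.
End power_groupoid.

Section pair_groupoid.
Context (r : nat).
Local Notation X := (discrete_topology 'I_r).
Local Notation A := (discrete_topology ('I_r * 'I_r)%type).

Let dcts (T : choiceType) (U : topologicalType) (f : discrete_topology T -> U) :
  continuous f.
Proof.
move=> x V /nbhs_singleton Vx.
by apply: (@filterS _ (nbhs x) _ [set x]); [move=> y ->|exact: discrete_set1].
Qed.

Let m_cts : {within [set p : A * A | p.1.2 = p.2.1],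
  continuous (fun p : A * A => ((p.1.1, p.2.2) : A))}.
Proof.
apply/(@gmul_ctsP A X snd fst (fun a b => (a.1, b.2))).
move=> g h gh U /nbhs_singleton Ugh.
exists [set g], [set h]; split; [exact: discrete_set1|exact: discrete_set1|].
by move=> _ _ -> ->.
Qed.

(* (i, j) has range i and source j. *)
Definition full_relation : topGroupoid.
Proof.
refine (@TopGroupoid A X snd fst (fun x => (x, x)) (fun g => (g.2, g.1))
  (fun g h => (g.1, h.2)) _ _ _ _ _ _ _ _ _ _ _ _ _ _ _ m_cts);
  by [|case|case=> [? ?] [? ?]|exact: dcts].
Defined.

Lemma full_relation_compact : compact [set: unit_space full_relation].
Proof. by apply: finite_compact; exact: (@finite_finset 'I_r). Qed.

Lemma full_relation_units_open : open (range (@gid full_relation)).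
Proof. exact: (@discrete_open A). Qed.
End pair_groupoid.

Section words.
Context (k : nat).

(* The alphabet {1, ..., k} is relabelled {0, ..., k - 1} = 'I_k. *)
Definition seqspace : topologicalType := {ptws nat -> discrete_topology 'I_k}.

Definition seq_shift (x : seqspace) : seqspace := fun n => x n.+1.

(* The concatenation of mu and z: past the end of mu, nth returns its default. *)
Definition wcat (mu : seq 'I_k) (z : seqspace) : seqspace :=
  fun n => nth (z (n - size mu)%N) mu n.

Lemma iter_seq_shiftE p x n : iter p seq_shift x n = x (p + n)%N.
Proof. by elim: p n => // p IH n; rewrite iterS /seq_shift IH addnS. Qed.

Lemma wcat_take p (x : seqspace) : wcat (mkseq x p) (iter p seq_shift x) = x.
Proof.
apply/funext => n; rewrite /wcat size_mkseq iter_seq_shiftE.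
have [np|pn] := ltnP n p; first by rewrite nth_mkseq.
by rewrite nth_default ?size_mkseq// subnKC.
Qed.

Lemma wcat_lt mu z n a : (n < size mu)%N -> wcat mu z n = nth a mu n.
Proof. by move=> nmu; apply: set_nth_default. Qed.

Lemma wcat_ge mu z n : wcat mu z (size mu + n)%N = z n.
Proof. by rewrite /wcat nth_default ?leq_addr// addKn. Qed.

Lemma shift_wcat mu z : iter (size mu) seq_shift (wcat mu z) = z.
Proof. by apply/funext => n; rewrite iter_seq_shiftE wcat_ge. Qed.

Lemma take_wcat mu z : mkseq (wcat mu z) (size mu) = mu.
Proof.
case: mu => // a mu; apply: (@eq_from_nth _ a) => [|n]; rewrite ?size_mkseq// => nmu.
by rewrite nth_mkseq// (wcat_lt _ a).
Qed.

Lemma wcat_inj mu nu z w : size mu = size nu -> wcat mu z = wcat nu w ->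
  mu = nu /\ z = w.
Proof.
move=> mn e; split; first by rewrite -(take_wcat mu z) e mn take_wcat.
by rewrite -(shift_wcat mu z) e mn shift_wcat.
Qed.

Lemma wcat_cat mu nu z : wcat (mu ++ nu) z = wcat mu (wcat nu z).
Proof.
apply/funext => n; rewrite /wcat nth_cat size_cat subnDA.
by case: ltnP => nmu; [exact: set_nth_default|rewrite [RHS]nth_default].
Qed.

Lemma wcat_split mu nu z w : (size mu <= size nu)%N -> wcat mu z = wcat nu w ->
  exists2 al, nu = mu ++ al & z = wcat al w.
Proof.
move=> le e; have nuE : nu = take (size mu) nu ++ drop (size mu) nu.
  by rewrite cat_take_drop.
move: e; rewrite {1}nuE wcat_cat => /wcat_inj[|mE ->].
  by rewrite size_takel.
by exists (drop (size mu) nu) => //; rewrite {1}mE cat_take_drop.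
Qed.

Lemma wcat_cts mu : continuous (wcat mu).
Proof.
apply: (@ptws_continuous seqspace nat (discrete_topology 'I_k)) => z n V nV.
have [nmu|mun] := ltnP n (size mu).
  apply: (@filterS _ (nbhs z) _ setT) => [w _|]; last exact: filterT.
  have := nbhs_singleton nV; rewrite /=.
  by rewrite !(wcat_lt _ (z 0) nmu).
have wE w : wcat mu w n = w (n - size mu)%N by rewrite /wcat nth_default.
move: nV; rewrite wE => nV.
have := @ptws_nbhs nat (discrete_topology 'I_k) z _ V nV.
by apply: filterS => w /=; rewrite wE.
Qed.

Lemma seq_shift_cts : continuous seq_shift.
Proof.
apply: (@ptws_continuous seqspace nat (discrete_topology 'I_k)) => z n V nV.
exact: (@ptws_nbhs nat (discrete_topology 'I_k) z _ V nV).
Qed.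

Lemma iter_seq_shift_cts p : continuous (iter p seq_shift).
Proof.
elim: p => [|p IH] z; first exact: cvg_id.
by apply: (@continuous_comp _ _ _ (iter p seq_shift) seq_shift z);
  [exact: IH|exact: seq_shift_cts].
Qed.

Lemma cylinder_open mu : open [set x : seqspace | mkseq x (size mu) = mu].
Proof.
rewrite openE => x /= xmu.
suff H n : nbhs x [set y : seqspace | mkseq y n = mkseq x n].
  by rewrite /interior; have := H (size mu); rewrite xmu.
elim: n => [|n IH].
  by apply: (@filterS _ (nbhs x) _ setT) => //; exact: filterT.
have := @ptws_nbhs nat (discrete_topology 'I_k) x n [set x n].
move=> /(_ (discrete_set1 _)) => H.
apply: (@filterS2 _ (nbhs x) _ _ _ _ _ IH H) => y /= e1 e2.
by rewrite !mkseqS e1 e2.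
Qed.

Lemma wcat_open mu (U : set seqspace) : open U -> open (wcat mu @` U).
Proof.
move=> oU; rewrite (_ : _ @` _ = [set x | mkseq x (size mu) = mu] `&`
  iter (size mu) seq_shift @^-1` U).
  apply: openI; first exact: cylinder_open.
  by apply: open_comp => // x _; exact: iter_seq_shift_cts.
apply/seteqP; split=> [_ [z Uz <-]|x [/= xmu Ux]].
  by split=> /=; rewrite ?take_wcat ?shift_wcat.
by exists (iter (size mu) seq_shift x) => //; rewrite -{1}xmu wcat_take.
Qed.

Lemma seqspace_compact : compact [set: seqspace].
Proof.
have Fc : compact [set: discrete_topology 'I_k].
  by apply: finite_compact; exact: (@finite_finset 'I_k).
have := @tychonoff nat (fun=> discrete_topology 'I_k) (fun=> setT) (fun=> Fc).
by congr (compact _); apply/seteqP; split.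
Qed.

End words.

Section cuntz_groupoid.
Context (k : nat).
Local Notation X := (seqspace k).

Definition cuntz_rel : set (X * int * X) :=
  [set t | exists p q : nat, t.1.2 = (p%:Z - q%:Z)%R /\
     iter p (@seq_shift k) t.1.1 = iter q (@seq_shift k) t.2].

Record cuntz_arrow := CuntzArrow {
  cuntz_val :> X * int * X;
  cuntz_valP : `[< cuntz_rel cuntz_val >] }.

HB.instance Definition _ := [isSub for cuntz_val].
HB.instance Definition _ := [Choice of cuntz_arrow by <:].

Definition cuntz_basic (mu nu : seq 'I_k) (U : set X) : set cuntz_arrow :=
  [set t | exists2 z, U z &
    cuntz_val t = (wcat mu z, ((size mu)%:Z - (size nu)%:Z)%R, wcat nu z)].

Definition cuntz_basis : set_system cuntz_arrow :=
  [set B | exists mu nu U, open U /\ B = cuntz_basic mu nu U].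

Lemma cuntz_at (t : cuntz_arrow) p q c : t.1.2 = (p%:Z - q%:Z)%R ->
  iter p (@seq_shift k) t.1.1 = iter q (@seq_shift k) t.2 ->
  exists mu nu z, [/\ size mu = (c + p)%N, size nu = (c + q)%N &
    cuntz_val t = (wcat mu z, ((size mu)%:Z - (size nu)%:Z)%R, wcat nu z)].
Proof.
move=> tpq e; exists (mkseq t.1.1 (c + p)), (mkseq t.2 (c + q)).
exists (iter (c + p) (@seq_shift k) t.1.1); split; rewrite ?size_mkseq//.
rewrite wcat_take iterD e -iterD wcat_take.
move: tpq; case: (cuntz_val t) => -[x m] y /= ->.
by congr (_, _, _); lia.
Qed.

Lemma cuntz_refine mu nu U mu' nu' z (t : cuntz_arrow) :
  cuntz_basic mu nu U t ->
  cuntz_val t = (wcat mu' z, ((size mu')%:Z - (size nu')%:Z)%R, wcat nu' z) ->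
  (size mu <= size mu')%N ->
  exists al, [/\ mu' = mu ++ al, nu' = nu ++ al & U (wcat al z)].
Proof.
move=> [w Uw ->] [e1 e2 e3] le.
have le' : (size nu <= size nu')%N by lia.
have [al muE wE] := wcat_split le e1.
have [be nuE wE'] := wcat_split le' e3.
have sz : size al = size be by move: e2; rewrite muE nuE !size_cat; lia.
move: wE'; rewrite wE => /(wcat_inj sz)[ab _].
by exists al; rewrite ab in muE wE *; split=> //; rewrite -wE.
Qed.

Let basic_cover : \bigcup_(B in cuntz_basis) B = setT.
Proof.
apply/seteqP; split=> // t _.
have /asboolP[p [q [tpq e]]] := cuntz_valP t.
have [mu [nu [z [_ _ tE]]]] := cuntz_at 0 tpq e.
exists (cuntz_basic mu nu setT); last by exists z.
by exists mu, nu, setT; split=> //; exact: openT.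
Qed.

Lemma cuntz_basicI mu nu U mu' nu' U' t : open U -> open U' ->
  (size mu <= size mu')%N -> cuntz_basic mu nu U t -> cuntz_basic mu' nu' U' t ->
  exists V, [/\ open V, cuntz_basic mu' nu' V t &
    cuntz_basic mu' nu' V `<=` cuntz_basic mu nu U `&` cuntz_basic mu' nu' U'].
Proof.
move=> oU oU' le tU [z U'z tE].
have [al [muE nuE Ualz]] := cuntz_refine tU tE le.
exists (U' `&` wcat al @^-1` U); split.
- by apply: openI => //; apply: open_comp => // x _; exact: wcat_cts.
- by exists z.
- move=> s [w [U'w Uw] sE]; split; last by exists w.
  exists (wcat al w) => //; rewrite sE muE nuE !wcat_cat !size_cat.
  by congr (_, _, _); lia.
Qed.

Let basic_join (B C : set cuntz_arrow) t : cuntz_basis B -> cuntz_basis C ->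
  B t -> C t -> exists D, [/\ cuntz_basis D, D t & D `<=` B `&` C].
Proof.
move=> [mu [nu [U [oU ->]]]] [mu' [nu' [U' [oU' ->]]]] ti tj.
have [le|/ltnW le] := leqP (size mu) (size mu').
  have [V [oV Vt sub]] := cuntz_basicI oU oU' le ti tj.
  by exists (cuntz_basic mu' nu' V); split=> //; exists mu', nu', V.
have [V [oV Vt sub]] := cuntz_basicI oU' oU le tj ti.
exists (cuntz_basic mu nu V); split=> //; first by exists mu, nu, V.
by rewrite setIC.
Qed.

HB.instance Definition _ := @isBaseTopological.Build cuntz_arrow
  (set cuntz_arrow) cuntz_basis id basic_cover basic_join.

Lemma cuntz_basic_open mu nu U : open U -> open (cuntz_basic mu nu U).
Proof.
move=> oU; exists [set cuntz_basic mu nu U]; last by rewrite bigcup_set1.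
by move=> _ ->; exists mu, nu, U.
Qed.

Lemma cuntz_nbhs (t : cuntz_arrow) (W : set cuntz_arrow) : nbhs t W ->
  exists mu nu U, [/\ open U, cuntz_basic mu nu U t & cuntz_basic mu nu U `<=` W].
Proof.
rewrite nbhsE => -[V [[D Dbasis <-] [B DB Bt]] VW].
have [mu [nu [U [oU BE]]]] := Dbasis _ DB.
exists mu, nu, U; rewrite -BE; split=> // s Bs.
by apply: VW; exists B.
Qed.

Lemma cuntz_basic_nbhs mu nu U t : open U -> cuntz_basic mu nu U t ->
  nbhs t (cuntz_basic mu nu U).
Proof.
by move=> oU tU; apply: open_nbhs_nbhs; split=> //; exact: cuntz_basic_open.
Qed.

Definition cuntz_src (t : cuntz_arrow) : X := t.2.
Definition cuntz_rng (t : cuntz_arrow) : X := t.1.1.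

Lemma cuntz_gidP (x : X) : `[< cuntz_rel (x, 0%R, x) >].
Proof. by apply/asboolP; exists 0, 0. Qed.
Definition cuntz_gid (x : X) : cuntz_arrow := CuntzArrow (cuntz_gidP x).

Lemma cuntz_ginvP (t : cuntz_arrow) : `[< cuntz_rel (t.2, (- t.1.2)%R, t.1.1) >].
Proof.
have /asboolP[p [q [tpq e]]] := cuntz_valP t.
by apply/asboolP; exists q, p; split=> //=; rewrite tpq; lia.
Qed.
Definition cuntz_ginv (t : cuntz_arrow) : cuntz_arrow :=
  CuntzArrow (cuntz_ginvP t).

(* On composable pairs the triple lies in cuntz_rel (see cuntz_gmulE); insubd
   only supplies a dummy value elsewhere. *)
Definition cuntz_gmul (t u : cuntz_arrow) : cuntz_arrow :=
  insubd t (t.1.1, (t.1.2 + u.1.2)%R, u.2).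

Lemma cuntz_at2 (t u : cuntz_arrow) c : cuntz_src t = cuntz_rng u ->
  exists al be ga z, [/\ (c <= size al)%N,
    cuntz_val t = (wcat al z, ((size al)%:Z - (size be)%:Z)%R, wcat be z) &
    cuntz_val u = (wcat be z, ((size be)%:Z - (size ga)%:Z)%R, wcat ga z)].
Proof.
move=> tu.
have /asboolP[p [q [tpq e]]] := cuntz_valP t.
have /asboolP[p' [q' [upq e']]] := cuntz_valP u.
have [al [be [z [sal sbe tE]]]] := cuntz_at (c + p') tpq e.
have [be' [ga [z' [sbe' sga uE]]]] := cuntz_at (c + q) upq e'.
move: (tu); rewrite /cuntz_src /cuntz_rng tE uE /= => /wcat_inj[|bE zE].
  by rewrite sbe sbe'; lia.
by subst be' z'; exists al, be, ga, z; split=> //; lia.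
Qed.

Lemma cuntz_gmulE (t u : cuntz_arrow) : cuntz_src t = cuntz_rng u ->
  cuntz_val (cuntz_gmul t u) = (t.1.1, (t.1.2 + u.1.2)%R, u.2).
Proof.
move=> tu; rewrite /cuntz_gmul [LHS]insubdK// unfold_in /=.
have [al [be [ga [z [_ tE uE]]]]] := cuntz_at2 0 tu.
apply/asboolP; exists (size al), (size ga).
by rewrite tE uE /= !shift_wcat; split=> //; lia.
Qed.

Lemma cuntz_eq (t u : cuntz_arrow) : t.1.1 = u.1.1 -> t.1.2 = u.1.2 ->
  t.2 = u.2 -> t = u.
Proof.
move=> e1 e2 e3; apply: val_inj => /=; move: e1 e2 e3.
by case: (cuntz_val t) (cuntz_val u) => -[? ?] ? [[? ?] ?] /= -> -> ->.
Qed.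

Lemma cuntz_src_cts : continuous cuntz_src.
Proof.
move=> t U; rewrite nbhsE => -[Y [Yo Yt] YU].
have /asboolP[p [q [tpq e]]] := cuntz_valP t.
have [mu [nu [z [_ _ tE]]]] := cuntz_at 0 tpq e.
have Vo : open (wcat nu @^-1` Y) by apply: open_comp => // x _; exact: wcat_cts.
have tV : cuntz_basic mu nu (wcat nu @^-1` Y) t.
  by exists z => //; move: Yt; rewrite /cuntz_src tE.
apply: filterS (cuntz_basic_nbhs Vo tV) => s [w Yw sE].
by apply: YU; rewrite /cuntz_src sE.
Qed.

Lemma cuntz_ginv_cts : continuous cuntz_ginv.
Proof.
move=> t W /cuntz_nbhs[mu [nu [U [oU [z Uz tE] sub]]]].
have tV : cuntz_basic nu mu U t.
  exists z => //; move: tE => [<- e <-].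
  by case: (cuntz_val t) e => -[x m] y /= e; congr (_, _, _); lia.
apply: filterS (cuntz_basic_nbhs oU tV) => s [w Ow sE].
by apply: sub; exists w => //=; rewrite sE /=; congr (_, _, _); lia.
Qed.

Lemma cuntz_rng_cts : continuous cuntz_rng.
Proof.
move=> t; apply: (@continuous_comp _ _ _ cuntz_ginv cuntz_src).
  exact: cuntz_ginv_cts.
exact: cuntz_src_cts.
Qed.

Lemma cuntz_gid_cts : continuous cuntz_gid.
Proof.
move=> x W /cuntz_nbhs[mu [nu [U [oU [z Uz [e1 e2 e3]] sub]]]].
have [mn _] : mu = nu /\ z = z by apply: wcat_inj; [lia|rewrite -e1].
have nx : nbhs x (wcat mu @` U).
  by apply: open_nbhs_nbhs; split; [exact: wcat_open|exists z].
apply: filterS nx => _ [w Uw <-]; apply: sub; exists w => //.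
by rewrite -mn /= subrr.
Qed.

Lemma cuntz_gmul_cts : {within
  [set p : cuntz_arrow * cuntz_arrow | cuntz_src p.1 = cuntz_rng p.2],
  continuous (fun p => cuntz_gmul p.1 p.2)}.
Proof.
apply/gmul_ctsP => t u tu W /cuntz_nbhs[mu [nu [U [oU tuU sub]]]].
have [al [be [ga [z [le tE uE]]]]] := cuntz_at2 (size mu) tu.
have mE : cuntz_val (cuntz_gmul t u) =
    (wcat al z, ((size al)%:Z - (size ga)%:Z)%R, wcat ga z).
  by rewrite cuntz_gmulE// tE uE /=; congr (_, _, _); lia.
have [de [alE gaE Uz]] := cuntz_refine tuU mE le.
have oV : open (wcat de @^-1` U) by apply: open_comp => // x _; exact: wcat_cts.
exists (cuntz_basic al be (wcat de @^-1` U)).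
exists (cuntz_basic be ga (wcat de @^-1` U)); split.
- by apply: cuntz_basic_nbhs => //; exists z.
- by apply: cuntz_basic_nbhs => //; exists z.
move=> t' u' [v Uv t'E] [v' Uv' u'E] tu'; apply: sub.
exists (wcat de v) => //; rewrite cuntz_gmulE//.
move: tu'; rewrite /cuntz_src /cuntz_rng t'E u'E /= => /wcat_inj[//|_ <-].
by rewrite alE gaE !wcat_cat !size_cat; congr (_, _, _); lia.
Qed.

Definition cuntz_groupoid : topGroupoid.
Proof.
refine (@TopGroupoid cuntz_arrow X cuntz_src cuntz_rng cuntz_gid cuntz_ginv
  cuntz_gmul _ _ _ _ _ _ _ _ _ _ _ cuntz_src_cts cuntz_rng_cts cuntz_gid_cts
  cuntz_ginv_cts cuntz_gmul_cts) => //.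
- by move=> g h gh; rewrite /cuntz_src cuntz_gmulE.
- by move=> g h gh; rewrite /cuntz_rng cuntz_gmulE.
- move=> g h l gh hl.
  have ghl : cuntz_src g = cuntz_rng (cuntz_gmul h l).
    by rewrite /cuntz_rng cuntz_gmulE.
  have ghl' : cuntz_src (cuntz_gmul g h) = cuntz_rng l.
    by rewrite /cuntz_src cuntz_gmulE.
  by apply: cuntz_eq; rewrite !cuntz_gmulE//= addrA.
- by move=> g; apply: cuntz_eq; rewrite cuntz_gmulE//= add0r.
- by move=> g; apply: cuntz_eq; rewrite cuntz_gmulE//= addr0.
- by move=> g; apply: cuntz_eq; rewrite cuntz_gmulE//= addNr.
- by move=> g; apply: cuntz_eq; rewrite cuntz_gmulE//= addrN.
Defined.

Lemma cuntz_unit_compact : compact [set: unit_space cuntz_groupoid].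
Proof. exact: seqspace_compact. Qed.

Lemma cuntz_units_open : open (range (@gid cuntz_groupoid)).
Proof.
rewrite (_ : range _ = cuntz_basic [::] [::] setT).
  by apply: cuntz_basic_open; exact: openT.
have w0 (z : X) : wcat [::] z = z by apply/funext => n; rewrite /wcat nth_nil subn0.
apply/seteqP; split=> [_ [x _ <-]|t [z _ tE]]; first by exists x; rewrite //= w0.
by exists z => //; apply: val_inj; rewrite /= tE w0.
Qed.

End cuntz_groupoid.

Section brin_higman_thompson.
Context (n k r : nat).

Definition bht_groupoid : topGroupoid :=
  prod_groupoid (full_relation r) (pow_groupoid 'I_n (cuntz_groupoid k)).

Lemma bht_unit_compact : compact [set: unit_space bht_groupoid].
Proof.
apply: prod_unit_compact; first exact: full_relation_compact.
by apply: pow_unit_compact; exact: cuntz_unit_compact.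
Qed.

Lemma bht_units_open : open (range (@gid bht_groupoid)).
Proof.
apply: prod_units_open; first exact: full_relation_units_open.
by apply: pow_units_open; exact: cuntz_units_open.
Qed.

Definition brin_higman_thompson : groupType :=
  topological_full_group bht_unit_compact bht_units_open.

End brin_higman_thompson.

Local Open Scope ring_scope.
Local Open Scope complex_scope.

Section l2_def.
Context (R : realType) (H : choiceType).
Implicit Types f g : H -> R[i].

Definition sqsum f : \bar R :=
  (\esum_(h in [set: H]) (Normc.normc (f h) ^+ 2)%:E)%E.

Definition square_summable : {pred H -> R[i]} := fun f => (sqsum f < +oo)%E.

Let esumZ_lt (c : R) f : 0 <= c -> (sqsum f < +oo)%E ->
  (\esum_(h in [set: H]) (c * Normc.normc (f h) ^+ 2)%:E < +oo)%E.
Proof.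
move=> c0 ff; apply: (@le_lt_trans _ _ (c%:E * sqsum f)%E); last first.
  have : (0 <= sqsum f)%E by apply: esum_ge0 => h _; rewrite lee_fin sqr_ge0.
  by move: ff; case: (sqsum f) => //= r _ _; rewrite ltry.
apply: ge_ereal_sup => _ [X [fX _]] <-.
under eq_fsbigr do rewrite EFinM.
rewrite -ge0_mule_fsumr; last by move=> h; rewrite lee_fin sqr_ge0.
apply: lee_wpmul2l; first by rewrite lee_fin.
by apply: ereal_sup_ubound; exists X.
Qed.

Lemma square_summable_submod_closed : submod_closed square_summable.
Proof.
split.
  rewrite unfold_in /sqsum esum1 ?ltry// => h _.
  by rewrite [Normc.normc _]Normc.normc0 expr0n.
move=> a f g; rewrite !unfold_in => ff fg.
have cge : 0 <= 2 * Normc.normc a ^+ 2 by apply: mulr_ge0; [exact: ler0n | exact: sqr_ge0].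
apply: le_lt_trans (lte_add_pinfty (esumZ_lt cge ff) (esumZ_lt (ler0n _ 2) fg)).
rewrite -esumD; [|by move=> h _; rewrite lee_fin; apply: mulr_ge0; rewrite ?sqr_ge0 ?ler0n..].
apply: le_esum => h _; rewrite -EFinD lee_fin.
rewrite -mulrA -exprMn -Normc.normcM -mulrDr.
rewrite [X in Normc.normc X](_ : _ = a * f h + g h)//.
have n_ge0 (z : R[i]) : 0 <= Normc.normc z by case: z => x y; exact: sqrtr_ge0.
have := le_normcD (a * f h) (g h).
move: (n_ge0 (a * f h + g h)) (n_ge0 (a * f h)) (n_ge0 (g h)).
set u := Normc.normc (_ + _); set v := Normc.normc (_ * _).
set w := Normc.normc _ => u0 v0 w0 uvw.
have : u ^+ 2 <= (v + w) ^+ 2 by rewrite ler_pXn2r// nnegrE addr_ge0.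
by have := sqr_ge0 (v - w); rewrite sqrrB sqrrD; lra.
Qed.

HB.instance Definition _ := GRing.isSubmodClosed.Build R[i] (H -> R[i])
  square_summable square_summable_submod_closed.

Record l2 := L2 { l2_fun :> H -> R[i]; l2P : l2_fun \in square_summable }.

HB.instance Definition _ := [isSub for l2_fun].
HB.instance Definition _ := [Choice of l2 by <:].
HB.instance Definition _ := [SubChoice_isSubLmodule of l2 by <:].

Definition l2norm (xi : l2) : R := Num.sqrt (fine (sqsum xi)).

(* Meaningful for bounded operators only: the infimum of an empty set is 0. *)
Definition opnorm (T : l2 -> l2) : R :=
  inf [set M : R | 0 <= M /\ forall xi, l2norm (T xi) <= M * l2norm xi].

Definition bounded_operator (T : l2 -> l2) : Prop :=
  linear T /\ exists M : R, forall xi, l2norm (T xi) <= M * l2norm xi.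

(* The operator-norm closure, within the bounded operators, of a set of bounded
   operators. *)
Definition opclosure (A : set (l2 -> l2)) : set (l2 -> l2) :=
  [set T | bounded_operator T /\
    forall e : R, 0 < e -> exists2 S, A S & opnorm (T - S) < e].

Definition closed_ideal (A I : set (l2 -> l2)) : Prop :=
  [/\ I `<=` A, I 0,
      (forall a S T, I S -> I T -> I (a *: S + T)),
      (forall S T, A S -> I T -> I (S \o T) /\ I (T \o S)) &
      opclosure I `<=` I].

Definition simple_opalg (A : set (l2 -> l2)) : Prop :=
  forall I, closed_ideal A I -> I = [set 0] \/ I = A.

End l2_def.

Section reduced_group_algebra.
Context (R : realType) (H : groupType).
Local Open Scope group_scope.

Lemma square_summable_translate (g : H) (xi : l2 R H) :
  (fun h => xi (g^-1 * h)) \in @square_summable R H.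
Proof.
have := l2P xi; rewrite !unfold_in /sqsum; congr (_ < +oo)%E.
apply: (@reindex_esum _ _ _ _ _ (fun h => g^-1 * h)); split=> //.
- by move=> x y _ _ /mulgI.
- by move=> x _; exists (g * x) => //; rewrite mulKg.
Qed.

Definition left_regular (g : H) (xi : l2 R H) : l2 R H :=
  L2 (square_summable_translate g xi).

(* The norm closure of the image of the group algebra C[H] in B(l2 H); the group
   H is discrete. *)
Definition cstar_r : set (l2 R H -> l2 R H) :=
  opclosure [set T | exists s : seq (R[i] * H),
    T = (\sum_(p <- s) p.1 *: left_regular p.2)%R].

Definition cstar_simple : Prop := simple_opalg cstar_r.

End reduced_group_algebra.

(* Main.v *)
(* A nonzero closed ideal of the reduced C*-algebra contains an operator whose
   coefficient at 1 is 1. Approximating it by an element of the group algebra and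
   averaging its conjugates brings it close to the identity, provided that for
   every finite set F of nontrivial elements suitable averages of the conjugates
   u f u^-1 are simultaneously small for f in F. For nV_{k,r}, choose points x_f
   with f x_f' <> x_f for all f, f' in F, and a depth d such that f maps no box of
   depth d around an x_f' into the box around x_f. For each word a of length L let
   u_a be the involution, supported on the union of these boxes, that exchanges b z
   and a b z for all words b <> a of length L. On the box around x_f the commutator
   of u_a with f is just u_a, and the maps u_a play ping-pong there, so the sum over
   a of the u_a f u_a^-1 has norm at most 2 sqrt(k^L), out of k^L terms. *)

Require Import Defs.
From HB Require Import structures.
From mathcomp Require Import all_boot all_order all_algebra complex.
From mathcomp Require Import all_classical all_reals all_analysis.
From mathcomp Require Import zify ring lra.

Set Implicit Arguments.
Unset Strict Implicit.
Unset Printing Implicit Defensive.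

Import Order.TTheory GRing.Theory Num.Theory.
Import numFieldNormedType.Exports.

Local Open Scope classical_set_scope.
Local Open Scope ring_scope.
Local Open Scope complex_scope.

(** * The modulus of complex numbers *)

Section normc_lemmas.
Context (R : realType).
Implicit Types z w : R[i].

Lemma normc_ge0 z : 0 <= Normc.normc z.
Proof. by case: z => a b; exact: sqrtr_ge0. Qed.

Lemma normc_sum (I : Type) (s : seq I) (P : pred I) (F : I -> R[i]) :
  Normc.normc (\sum_(i <- s | P i) F i) <= \sum_(i <- s | P i) Normc.normc (F i).
Proof.
elim/big_rec2: _ => [|i x y _ le]; first by rewrite Normc.normc0.
by apply: le_trans (le_normcD _ _) _; rewrite lerD2l.
Qed.

Lemma normc_real (x : R) : Normc.normc x%:C = `|x|.
Proof. by rewrite /= expr0n addr0 sqrtr_sqr. Qed.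

End normc_lemmas.

(** * The norm of the Hilbert space l2 *)

Section l2_lemmas.
Context (R : realType) (H : choiceType).
Implicit Types (xi eta : l2 R H) (s : seq H).
Local Notation nc := Normc.normc.

Lemma sqsum_ge0 (f : H -> R[i]) : (0 <= sqsum f)%E.
Proof. by apply: esum_ge0 => h _; rewrite lee_fin sqr_ge0. Qed.

Lemma l2norm_ge0 xi : 0 <= l2norm xi.
Proof. exact: sqrtr_ge0. Qed.

Lemma l2norm_sqrE xi : (l2norm xi ^+ 2)%:E = sqsum xi.
Proof.
have := sqsum_ge0 xi; have := l2P xi; rewrite unfold_in => lt ge.
rewrite sqr_sqrtr ?fine_ge0// fineK// ge0_fin_numE//.
Qed.

Lemma sum_le_l2norm xi s : uniq s ->
  \sum_(h <- s) nc (xi h) ^+ 2 <= l2norm xi ^+ 2.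
Proof.
move=> us; rewrite -lee_fin l2norm_sqrE; apply: esum_ge.
exists [set` s]; first by split=> //; exact: finite_seq.
by rewrite -fsbig_seq// sumEFin.
Qed.

(** The extended sum is a supremum over finite sets, so upper bounds on norms reduce to sums over
    duplicate-free sequences. *)
Lemma sqsum_le (f : H -> R[i]) (M : R) :
  (forall s, uniq s -> \sum_(h <- s) nc (f h) ^+ 2 <= M) -> (sqsum f <= M%:E)%E.
Proof.
move=> fM; apply: ge_ereal_sup => _ [X [fX _] <-].
by rewrite fsbig_finite//= sumEFin lee_fin fM.
Qed.

Lemma l2norm_le xi (M : R) : 0 <= M ->
  (forall s, uniq s -> \sum_(h <- s) nc (xi h) ^+ 2 <= M ^+ 2) -> l2norm xi <= M.
Proof.
move=> M0 /sqsum_le; rewrite -l2norm_sqrE lee_fin.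
by rewrite ler_pXn2r// nnegrE l2norm_ge0.
Qed.

Lemma normc_le_l2norm xi h : nc (xi h) <= l2norm xi.
Proof.
have := @sum_le_l2norm xi [:: h] isT; rewrite big_seq1.
by rewrite ler_pXn2r// nnegrE ?l2norm_ge0 ?normc_ge0.
Qed.

Lemma l2_addE xi eta h : (xi + eta) h = xi h + eta h. Proof. by []. Qed.
Lemma l2_oppE xi h : (- xi) h = - xi h. Proof. by []. Qed.
Lemma l2_scaleE c xi h : (c *: xi) h = c * xi h. Proof. by []. Qed.
Lemma l2_sumE (I : Type) (r : seq I) (P : pred I) (F : I -> l2 R H) h :
  (\sum_(i <- r | P i) F i) h = \sum_(i <- r | P i) F i h.
Proof. by elim/big_rec2: _ => // i x y _ <-. Qed.

Lemma l2_eq xi eta : (forall h, xi h = eta h) -> xi = eta.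
Proof. by move=> e; apply: val_inj; apply/funext. Qed.

Lemma l2norm_scale c xi : l2norm (c *: xi) = nc c * l2norm xi.
Proof.
have le a (x : l2 R H) : l2norm (a *: x) <= nc a * l2norm x.
  apply: l2norm_le => [|s us]; first by rewrite mulr_ge0 ?normc_ge0 ?l2norm_ge0.
  rewrite exprMn; under eq_bigr do rewrite l2_scaleE Normc.normcM exprMn.
  by rewrite -mulr_sumr ler_wpM2l ?sqr_ge0 ?sum_le_l2norm.
apply/eqP; rewrite eq_le le /=.
have [->|c0] := eqVneq c 0; first by rewrite Normc.normc0 mul0r l2norm_ge0.
have nc0 : 0 < nc c.
  by rewrite lt_def normc_ge0 andbT; apply: contra c0 => /eqP/Normc.eq0_normc ->.
(* The reverse inequality is [le] for the scalar [c^-1] and the vector [c *: xi]. *)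
rewrite -ler_pdivlMl// -Normc.normcV.
by apply: le_trans (le _ _); rewrite scalerA mulVf// scale1r.
Qed.

Lemma l2norm0 : l2norm (0 : l2 R H) = 0.
Proof. by rewrite -(scale0r 0) l2norm_scale Normc.normc0 mul0r. Qed.

Lemma l2normN xi : l2norm (- xi) = l2norm xi.
Proof.
rewrite -scaleN1r l2norm_scale (_ : nc (-1) = 1) ?mul1r//.
by rewrite /= oppr0 sqrrN expr1n expr0n addr0 sqrtr1.
Qed.

(* Young's inequality [(x + y)^2 <= (1 + B/A) x^2 + (1 + A/B) y^2] with A, B
   slightly above the two norms. *)
Lemma l2normD xi eta : l2norm (xi + eta) <= l2norm xi + l2norm eta.
Proof.
apply/ler_addgt0Pr => e e0.
set A := l2norm xi + e / 2; set B := l2norm eta + e / 2.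
have A0 : 0 < A by rewrite /A; have := l2norm_ge0 xi; lra.
have B0 : 0 < B by rewrite /B; have := l2norm_ge0 eta; lra.
rewrite (_ : _ + e = A + B); last by rewrite /A /B; lra.
apply: l2norm_le => [|s us]; first by rewrite addr_ge0// ltW.
have young (x y z : R) : 0 <= x -> 0 <= y -> 0 <= z -> z <= x + y ->
    A * B * z ^+ 2 <= (A + B) * (B * x ^+ 2 + A * y ^+ 2).
  move=> x0 y0 z0 zxy.
  have : z ^+ 2 <= (x + y) ^+ 2 by rewrite ler_pXn2r ?nnegrE ?addr_ge0.
  rewrite -(ler_pM2l (mulr_gt0 A0 B0)) => /le_trans; apply.
  (* The difference of the two sides is exactly this square. *)
  have := sqr_ge0 (B * x - A * y); nra.
rewrite -(ler_pM2l (mulr_gt0 A0 B0)) mulr_sumr.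
apply: (@le_trans _ _ (\sum_(h <- s)
    (A + B) * (B * nc (xi h) ^+ 2 + A * nc (eta h) ^+ 2))).
  by apply: ler_sum => h _; apply: young; rewrite ?normc_ge0 ?le_normcD.
rewrite -mulr_sumr big_split/= -!mulr_sumr.
have sqA : \sum_(h <- s) nc (xi h) ^+ 2 <= A ^+ 2.
  apply: le_trans (sum_le_l2norm _ us) _.
  by rewrite ler_pXn2r ?nnegrE ?l2norm_ge0 ?(ltW A0)// /A; lra.
have sqB : \sum_(h <- s) nc (eta h) ^+ 2 <= B ^+ 2.
  apply: le_trans (sum_le_l2norm _ us) _.
  by rewrite ler_pXn2r ?nnegrE ?l2norm_ge0 ?(ltW B0)// /B; lra.
rewrite (_ : A * B * _ = (A + B) * (B * A ^+ 2 + A * B ^+ 2)); last by ring.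
apply: ler_wpM2l; first by rewrite addr_ge0 ?ltW.
by rewrite lerD// ler_wpM2l// ltW.
Qed.

Lemma l2norm_sum (I : Type) (r : seq I) (P : pred I) (F : I -> l2 R H) :
  l2norm (\sum_(i <- r | P i) F i) <= \sum_(i <- r | P i) l2norm (F i).
Proof.
elim/big_rec2: _ => [|i x y _ le]; first by rewrite l2norm0.
by apply: le_trans (l2normD _ _) _; rewrite lerD2l.
Qed.

Let delta_sum_le (x : H) s : uniq s ->
  \sum_(h <- s) nc (if h == x then 1 else 0 : R[i]) ^+ 2 <= 1.
Proof.
move=> us; rewrite (eq_bigr (fun h => if h == x then 1 else 0)) => [|h _]; last first.
  by case: ifP; rewrite ?Normc.normc1 ?Normc.normc0 ?expr1n ?expr0n.
rewrite -big_mkcond; have [xs|xs] := boolP (x \in s).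
  by rewrite -big_filter filter_pred1_uniq// big_seq1.
by rewrite big1_seq// => h /andP[/eqP->]; rewrite (negPf xs).
Qed.

Lemma delta_subproof (x : H) :
  (fun h => if h == x then 1 else 0) \in @square_summable R H.
Proof.
rewrite unfold_in; apply: (@le_lt_trans _ _ 1%:E); last exact: ltry.
by apply: sqsum_le => s; exact: delta_sum_le.
Qed.

Definition delta (x : H) : l2 R H := L2 (delta_subproof x).

Lemma l2norm_delta x : l2norm (delta x) <= 1.
Proof. by apply: l2norm_le => // s us; rewrite expr1n; exact: delta_sum_le. Qed.

End l2_lemmas.

(** * Translation operators, operator bounds and the ping-pong estimate *)

Section regular_representation.
Context (R : realType) (H : groupType).
Implicit Types (g h : H) (xi eta : l2 R H) (T S : l2 R H -> l2 R H).
Local Notation nc := Normc.normc.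
Local Notation lam := (@left_regular R H).

Lemma left_regularE g xi h : lam g xi h = xi (g^-1 * h)%g. Proof. by []. Qed.

Lemma left_regularM g h xi : lam (g * h)%g xi = lam g (lam h xi).
Proof. by apply: l2_eq => x; rewrite !left_regularE invgM mulgA. Qed.

Lemma left_regular1 xi : lam 1%g xi = xi.
Proof. by apply: l2_eq => x; rewrite left_regularE invg1 mul1g. Qed.

Lemma left_regular_linear g : linear (lam g).
Proof. by move=> a x y; apply: l2_eq. Qed.

Lemma l2norm_left_regular g xi : l2norm (lam g xi) = l2norm xi.
Proof.
have le a (x : l2 R H) : l2norm (lam a x) <= l2norm x.
  apply: l2norm_le => [|s us]; first exact: l2norm_ge0.
  have := @sum_le_l2norm R H x [seq (a^-1 * h)%g | h <- s].
  rewrite big_map; apply; rewrite map_inj_uniq//; exact: mulgI.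
apply/eqP; rewrite eq_le le /=.
by rewrite -{1}(left_regular1 xi) -(mulVg g) left_regularM le.
Qed.

Definition bounded_by (M : R) T := forall xi, l2norm (T xi) <= M * l2norm xi.

(** The bound [M] makes the set of admissible constants nonempty, so an infimum below [e] yields an
    admissible constant below [e]. *)
Lemma bounded_by_opnorm_lt T (M e : R) :
  bounded_by M T -> opnorm T < e -> bounded_by e T.
Proof.
move=> TM /inf_lt[|N [_ TN] Ne xi].
  exists (Num.max M 0); split=> [|xi]; first by rewrite le_max lexx orbT.
  by apply: le_trans (TM xi) _; rewrite ler_wpM2r ?l2norm_ge0// le_max lexx.
by apply: le_trans (TN xi) _; rewrite ler_wpM2r ?l2norm_ge0// ltW.
Qed.

Lemma opnorm_le T (M : R) : 0 <= M -> bounded_by M T -> opnorm T <= M.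
Proof.
by move=> M0 TM; apply: ge_inf; [exists 0 => x /= []|split].
Qed.

Lemma bounded_byB T S (M N : R) :
  bounded_by M T -> bounded_by N S -> bounded_by (M + N) (T - S).
Proof.
move=> TM SN xi; rewrite mulrDl fctE.
apply: le_trans (l2normD _ _) _; rewrite l2normN.
exact: lerD (TM xi) (SN xi).
Qed.

Definition group_algebra_op (s : seq (R[i] * H)) : l2 R H -> l2 R H :=
  \sum_(p <- s) p.1 *: lam p.2.

Lemma group_algebra_opE s xi :
  group_algebra_op s xi = \sum_(p <- s) p.1 *: lam p.2 xi.
Proof. by rewrite /group_algebra_op fct_sumE. Qed.

Lemma group_algebra_op_bounded s :
  bounded_by (\sum_(p <- s) nc p.1) (group_algebra_op s).
Proof.
move=> xi; rewrite group_algebra_opE; apply: le_trans (l2norm_sum _ _ _) _.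
rewrite mulr_suml; apply: ler_sum => p _.
by rewrite l2norm_scale l2norm_left_regular.
Qed.

Lemma opclosure_sub (A : set (l2 R H -> l2 R H)) T :
  A T -> bounded_operator T -> opclosure A T.
Proof.
move=> AT Tb; split=> // e e0; exists T => //.
apply: le_lt_trans e0; apply: opnorm_le => // xi.
by rewrite subrr mul0r l2norm0.
Qed.

Lemma left_regular_cstar_r g : @cstar_r R H (lam g).
Proof.
apply: opclosure_sub.
  by exists [:: (1, g)]; rewrite big_seq1 scale1r.
split; first exact: left_regular_linear.
by exists 1 => xi; rewrite l2norm_left_regular mul1r.
Qed.

Lemma opclosure_approx (A : set (l2 R H -> l2 R H)) T (e : R) :
  opclosure A T -> (forall S, A S -> exists M, bounded_by M S) -> 0 < e ->
  exists2 S, A S & bounded_by e (T - S).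
Proof.
move=> [[_ [M TM]] clT] Ab e0; have [S AS lt] := clT e e0; exists S => //.
by have [N SN] := Ab S AS; exact: bounded_by_opnorm_lt (bounded_byB TM SN) lt.
Qed.

Lemma cstar_r_approx T (e : R) : @cstar_r R H T -> 0 < e ->
  exists s, bounded_by e (T - group_algebra_op s).
Proof.
move=> clT e0; have [|_ [s ->] b] := opclosure_approx clT _ e0; last by exists s.
move=> _ [s ->]; eexists; exact: group_algebra_op_bounded.
Qed.

Lemma ler_sum_uniq_sub (T : eqType) (s t : seq T) (F : T -> R) :
  uniq s -> uniq t -> {subset s <= t} -> (forall x, 0 <= F x) ->
  \sum_(x <- s) F x <= \sum_(x <- t) F x.
Proof.
move=> us ut st F0.
have e : perm_eq s [seq x <- t | x \in s].
  apply: uniq_perm; [exact: us|exact: filter_uniq|move=> x].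
  rewrite mem_filter; have [xs|//] := boolP (x \in s); exact: esym (st _ xs).
rewrite (perm_big _ e) big_filter [leRHS](bigID (mem s))/=.
by rewrite lerDl; apply: sumr_ge0 => x _; exact: F0.
Qed.

(** Cauchy-Schwarz against the constant 1. With [z] the extension of [y] by 0, [M] and [Q] the sums
    of [z] and of its squares, and [m] the cardinal of [A], the sum of the squares of [m * z a - M]
    is [m * (m * Q - M ^+ 2)]. *)
Lemma sqr_sum_le_card (A : finType) (P : pred A) (y : A -> R) :
  (\sum_(a | P a) y a) ^+ 2 <= #|A|%:R * \sum_(a | P a) y a ^+ 2.
Proof.
rewrite big_mkcond [X in _ <= _ * X]big_mkcond /=.
set z := fun a => if P a then y a else 0.
have -> : \sum_(a : A) (if P a then y a ^+ 2 else 0) = \sum_(a : A) z a ^+ 2.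
  by apply: eq_bigr => a _; rewrite /z; case: ifP; rewrite ?expr0n.
set M := \sum_(a : A) z a.
have [A0|A0] := eqVneq #|A| 0%N.
  have -> : M = 0 by rewrite /M big1// => a _; have := card0_eq A0 a; rewrite inE.
  by rewrite expr0n mulr_ge0// sumr_ge0// => a _; rewrite sqr_ge0.
have m0 : 0 < #|A|%:R :> R by rewrite ltr0n lt0n.
set m : R := #|A|%:R in m0 *.
have : 0 <= \sum_(a : A) (m * z a - M) ^+ 2 by apply: sumr_ge0 => a _; exact: sqr_ge0.
rewrite (eq_bigr (fun a => m ^+ 2 * z a ^+ 2 + (- (2 * m * M) * z a + M ^+ 2)));
  last by move=> a _; ring.
rewrite 2!big_split/= -!mulr_sumr sumr_const -/M -[_ *+ #|_|]mulr_natl -/m.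
set Q := \sum_(a : A) z a ^+ 2 => Q0; rewrite -(ler_pM2l m0); nra.
Qed.

(* Writing xi as the sum over a of its restrictions to {key = a} and to its
   complement, the translates by w a of the latter have disjoint supports, and
   the former are themselves disjointly supported. *)
Lemma pingpong_norm (A : finType) (w : A -> H) (key : H -> A) :
  (forall a g, key g != a -> key (w a * g)%g = a) ->
  bounded_by (2 * Num.sqrt #|A|%:R) (fun xi => \sum_(a : A) lam (w a) xi).
Proof.
move=> ping xi; set N := l2norm xi; set m : R := #|A|%:R.
apply: l2norm_le => [|s us].
  by rewrite !mulr_ge0 ?l2norm_ge0 ?sqrtr_ge0.
have wK a : injective (fun h => (w a)^-1 * h)%g by exact: mulgI.
have key_sum (h : H) : nc (\sum_(a : A) xi ((w a)^-1 * h)%g) ^+ 2 <=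
    2 * \sum_(a : A) nc (xi ((w a)^-1 * h)%g) ^+ 2 +
    2 * (m * \sum_(a | key ((w a)^-1 * h)%g == a) nc (xi ((w a)^-1 * h)%g) ^+ 2).
  pose P a := key ((w a)^-1 * h)%g == a; pose x a := xi ((w a)^-1 * h)%g.
  (* An index outside [P] must be [key h], so the sum [v] below has at most one term. *)
  have nP a : ~~ P a -> key h = a.
    by move=> /ping; rewrite mulVKg.
  rewrite (bigID P)/=; set u := \sum_(a | P a) _; set v := \sum_(a | ~~ P a) _.
  have uE : nc u ^+ 2 <= m * \sum_(a | P a) nc (x a) ^+ 2.
    apply: le_trans (sqr_sum_le_card _ _).
    rewrite ler_pXn2r ?nnegrE ?normc_ge0 ?normc_sum//.
    by apply: sumr_ge0 => a _; exact: normc_ge0.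
  have vE : nc v ^+ 2 <= \sum_a nc (x a) ^+ 2.
    have [Ph|nPh] := boolP (P (key h)).
      rewrite /v big_pred0 => [|a].
        by rewrite Normc.normc0 expr0n sumr_ge0// => a _; exact: sqr_ge0.
      by apply/negbTE/negP => na; move: (na); rewrite -(nP _ na) Ph.
    rewrite /v (big_pred1 (key h)) => [|a]; last first.
      by apply/idP/eqP => [/nP|->].
    rewrite (bigD1 (key h))//= lerDl sumr_ge0// => a _; exact: sqr_ge0.
  have : nc (u + v) ^+ 2 <= (nc u + nc v) ^+ 2.
    by rewrite ler_pXn2r ?nnegrE ?addr_ge0 ?normc_ge0 ?le_normcD.
  have := sqr_ge0 (nc u - nc v); rewrite -/(x _); move: uE vE.
  rewrite /x /P; nra.
under eq_bigr do rewrite l2_sumE.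
apply: le_trans (ler_sum _ (fun h _ => key_sum h)) _.
rewrite big_split/= -!mulr_sumr exchange_big/=.
have le1 : \sum_(a : A) \sum_(h <- s) nc (xi ((w a)^-1 * h)%g) ^+ 2 <= m * N ^+ 2.
  rewrite mulr_natl -sumr_const; apply: ler_sum => a _.
  rewrite -(big_map (fun h => (w a)^-1 * h)%g predT (fun g => nc (xi g) ^+ 2)).
  by apply: sum_le_l2norm; rewrite map_inj_uniq.
have le2 : \sum_(h <- s) \sum_(a | key ((w a)^-1 * h)%g == a)
    nc (xi ((w a)^-1 * h)%g) ^+ 2 <= N ^+ 2.
  (* For fixed [a] the points of key [a] that occur are distinct entries of [t], and different [a]
     select disjoint parts of [t]; all of them together contribute a single [N ^+ 2]. *)
  pose t := undup (flatten [seq [seq ((w a)^-1 * h)%g | h <- s] | a <- enum A]).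
  apply: le_trans (@sum_le_l2norm _ _ xi t (undup_uniq _)).
  rewrite (exchange_big_dep predT)//=.
  rewrite [leRHS](_ : _ = \sum_(a : A) \sum_(g <- t | key g == a) nc (xi g) ^+ 2);
    last first.
    rewrite (exchange_big_dep predT)//=; apply: eq_bigr => g _.
    by rewrite (big_pred1 (key g)) => // a; rewrite eq_sym.
  apply: ler_sum => a _.
  rewrite -(big_map (fun h => (w a)^-1 * h)%g (fun g => key g == a)
    (fun g => nc (xi g) ^+ 2)).
  rewrite -[leLHS]big_filter -[leRHS]big_filter; apply: ler_sum_uniq_sub => [|||g].
  + by apply: filter_uniq; rewrite map_inj_uniq.
  + by apply: filter_uniq; exact: undup_uniq.
  + move=> g; rewrite !mem_filter => /andP[-> gs]; rewrite mem_undup.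
    by apply/flattenP; eexists; [apply: map_f; rewrite mem_enum|exact: gs].
  + exact: sqr_ge0.
have -> : (2 * Num.sqrt m * N) ^+ 2 = 2 * (m * N ^+ 2) + 2 * (m * N ^+ 2).
  have m0 : 0 <= m by exact: ler0n.
  rewrite 2!exprMn sqr_sqrtr; [ring|exact: m0].
apply: lerD; apply: ler_wpM2l; [exact: ler0n|exact: le1|exact: ler0n|].
apply: ler_wpM2l; [exact: ler0n|exact: le2].
Qed.

End regular_representation.

(** * An averaging criterion for C*-simplicity *)

Section powers_criterion.
Context (R : realType) (H : groupType).
Implicit Types (g h : H) (xi : l2 R H) (T S : l2 R H -> l2 R H).
Local Notation nc := Normc.normc.
Local Notation lam := (@left_regular R H).

(** The list [s] may repeat group elements; evaluation on the delta function at 1 collects their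
    total coefficient. *)
Lemma group_algebra_op_delta (s : seq (R[i] * H)) g :
  group_algebra_op s (delta R 1%g) g = \sum_(p <- s | p.2 == g) p.1.
Proof.
rewrite group_algebra_opE l2_sumE [RHS]big_mkcond; apply: eq_bigr => p _.
rewrite l2_scaleE left_regularE /= mulg_eq1 eqg_inv.
by case: ifP => _; rewrite ?mulr1 ?mulr0.
Qed.

Lemma group_algebra_op_coef (s : seq (R[i] * H)) xi h :
  group_algebra_op s xi h = \sum_(g <- undup [seq p.2 | p <- s])
    group_algebra_op s (delta R 1%g) g * xi (g^-1 * h)%g.
Proof.
rewrite group_algebra_opE l2_sumE; set t := undup _.
under [RHS]eq_bigr do rewrite group_algebra_op_delta mulr_suml.
rewrite (exchange_big_dep predT)//= !big_seq; apply: eq_bigr => p ps.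
rewrite [RHS]big_mkcond (bigD1_seq p.2) ?undup_uniq ?mem_undup ?map_f//=.
rewrite eqxx big1 ?addr0// => g; rewrite eq_sym => /negbTE ->.
by [].
Qed.

(** If [S] in the group algebra is within [e] of [T], the coefficients of [S] have l2 norm at most
    [e], because those of [T] vanish. As [S xi] is a convolution with these coefficients, each of
    its values is of order [e], and so is each value of [T xi]. *)
Lemma cstar_r_delta_eq0 T : @cstar_r R H T ->
  (forall g, T (delta R 1%g) g = 0) -> T = 0.
Proof.
move=> TA T0; apply/funext => xi; apply: l2_eq => h.
apply: Normc.eq0_normc; apply/eqP; rewrite eq_le normc_ge0 andbT.
(* Per unit of [e], the term [N] accounts for [T - S] and [(1 + N ^+ 2) / 2] for [S]. *)
set N := l2norm xi; pose K := N + (1 + N ^+ 2) / 2.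
have N0 : 0 <= N by exact: l2norm_ge0.
have K0 : 0 < K by rewrite /K; have := sqr_ge0 N; lra.
suff le e : 0 < e -> nc (T xi h) <= e * K.
  apply/ler_addgt0Pr => e e0; rewrite add0r.
  by apply: le_trans (le (e / K) _) _; rewrite ?divr_gt0// divfK// gt_eqF.
move=> e0; have [s sT] := cstar_r_approx TA e0.
set S := group_algebra_op s in sT; set t := undup [seq p.2 | p <- s].
pose c g := S (delta R 1%g) g.
have cE : \sum_(g <- t) nc (c g) ^+ 2 <= e ^+ 2.
  have nDd : l2norm ((T - S) (delta R 1%g)) <= e.
    apply: le_trans (sT _) _; rewrite ger_pMr//; exact: l2norm_delta.
  apply: (@le_trans _ _ (l2norm ((T - S) (delta R 1%g)) ^+ 2)).
    rewrite (eq_bigr (fun g => nc ((T - S) (delta R 1%g) g) ^+ 2)).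
      by apply: sum_le_l2norm; exact: undup_uniq.
    move=> g _; rewrite fctE l2_addE T0 add0r l2_oppE.
    by rewrite (_ : nc (- _) = nc (c g))// normcN.
  by rewrite ler_pXn2r ?nnegrE ?l2norm_ge0 ?(ltW e0).
have xE : \sum_(g <- t) nc (xi (g^-1 * h)%g) ^+ 2 <= N ^+ 2.
  rewrite -(big_map (fun g => g^-1 * h)%g predT (fun g => nc (xi g) ^+ 2)).
  apply: sum_le_l2norm; rewrite map_inj_uniq ?undup_uniq//.
  by move=> a b /mulIg/invg_inj.
have SE : nc (S xi h) <= e * ((1 + N ^+ 2) / 2).
  rewrite group_algebra_op_coef; apply: le_trans (normc_sum _ _ _) _.
  (* After multiplication by [2 * e], each term is bounded through [2 * e * c * x <= c ^+ 2 + e ^+ 2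
     * x ^+ 2]. *)
  rewrite -(ler_pM2l (mulr_gt0 (ltr0Sn R 1) e0)) mulr_sumr.
  apply: (@le_trans _ _ (\sum_(g <- t)
      (nc (c g) ^+ 2 + e ^+ 2 * nc (xi (g^-1 * h)%g) ^+ 2))).
    apply: ler_sum => g _; rewrite Normc.normcM.
    have := sqr_ge0 (nc (c g) - e * nc (xi (g^-1 * h)%g)).
    rewrite -/(c g); nra.
  rewrite big_split/= -mulr_sumr.
  have := ler_wpM2l (sqr_ge0 e) xE; move: cE; nra.
have TE : T xi h = (T - S) xi h + S xi h by rewrite fctE l2_addE l2_oppE subrK.
rewrite TE; apply: le_trans (le_normcD _ _) _.
rewrite /K mulrDr; apply: lerD SE.
exact: le_trans (normc_le_l2norm _ _) (sT xi).
Qed.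

(** Powers' averaging property, uniform in [F]: the same conjugators serve every [f]. The bound
    concerns the sum of the conjugates, so their mean has norm at most [e]. *)
Definition powers_averaging := forall (F : seq H) (e : R), 0 < e -> 1%g \notin F ->
  exists hs : seq H, hs != [::] /\
    forall f, f \in F -> bounded_by (e * (size hs)%:R)
      (fun xi => \sum_(h <- hs) lam (h * f * h^-1)%g xi).

Lemma closed_idealZ (A I : set (l2 R H -> l2 R H)) a T :
  closed_ideal A I -> I T -> I (a *: T).
Proof. by move=> [_ I0 IZ _ _] IT; rewrite -[a *: T]addr0; exact: IZ. Qed.

Lemma closed_ideal_sum (A I : set (l2 R H -> l2 R H)) (J : Type) (r : seq J)
    (F : J -> l2 R H -> l2 R H) :
  closed_ideal A I -> (forall j, I (F j)) -> I (\sum_(j <- r) F j).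
Proof.
move=> [_ I0 IZ _ _] IF; elim/big_ind: _ => // S T IS IT.
by rewrite -[S]scale1r; exact: IZ.
Qed.

(** Three errors of size [e] add up: the averaged conjugates of [T - S], the nontrivial part of [S]
    after averaging, and the distance from 1 of the coefficient of [S] at 1. *)
Lemma average_near_id T (e : R) : powers_averaging -> @cstar_r R H T ->
  T (delta R 1%g) 1%g = 1 -> 0 < e -> exists hs : seq H, hs != [::] /\
  bounded_by (3 * e) (((size hs)%:R^-1)%:C *:
    \sum_(h <- hs) (lam h \o (T \o lam h^-1%g)) - id).
Proof.
move=> avg TA T1 e0; have [s sT] := cstar_r_approx TA e0.
set S := group_algebra_op s in sT.
(* Averaging with tolerance [e / K] keeps the whole nontrivial part below [e]; the summand 1 makes
   [K] positive for every [s]. *)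
pose K := 1 + \sum_(p <- s) nc p.1.
have K0 : 0 < K by rewrite ltr_pwDl// sumr_ge0// => p _; exact: normc_ge0.
have [|hs [hs0 hsP]] := avg [seq g <- [seq p.2 | p <- s] | g != 1%g] (e / K) (divr_gt0 e0 K0).
  by rewrite mem_filter eqxx.
exists hs; split=> // xi.
set m : R := (size hs)%:R.
have m0 : 0 < m by rewrite ltr0n lt0n size_eq0.
pose c := \sum_(p <- s | p.2 == 1%g) p.1.
have c1 : nc (c - 1) <= e.
  have -> : c - 1 = - ((T - S) (delta R 1%g) 1%g).
    by rewrite fctE l2_addE l2_oppE T1 group_algebra_op_delta opprB.
  rewrite normcN; apply: le_trans (normc_le_l2norm _ _) _.
  by apply: le_trans (sT _) _; rewrite ger_pMr//; exact: l2norm_delta.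
pose X := \sum_(h <- hs) lam h ((T - S) (lam h^-1%g xi)).
pose Y := \sum_(p <- s | p.2 != 1%g)
  p.1 *: \sum_(h <- hs) lam (h * p.2 * h^-1)%g xi.
have lamD g : {morph lam g : x y / x + y} by move=> x y; exact: l2_eq.
have lamS h : lam h (S (lam h^-1%g xi)) =
    \sum_(p <- s) p.1 *: lam (h * p.2 * h^-1)%g xi.
  rewrite /S group_algebra_opE; apply: l2_eq => x.
  rewrite left_regularE !l2_sumE; apply: eq_bigr => p _.
  by rewrite !l2_scaleE !left_regularM.
have E : \sum_(h <- hs) lam h (T (lam h^-1%g xi)) = X + (Y + (m%:C * c) *: xi).
  rewrite /X (eq_bigr (fun h => lam h ((T - S) (lam h^-1%g xi)) +
      lam h (S (lam h^-1%g xi)))); last first.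
    by move=> h _; rewrite -lamD fctE subrK.
  rewrite big_split/=; congr (_ + _); under eq_bigr do rewrite lamS.
  rewrite exchange_big/= (bigID (fun p => p.2 == 1%g))/= addrC; congr (_ + _).
    by apply: eq_bigr => p _; rewrite scaler_sumr.
  rewrite mulr_sumr scaler_suml; apply: eq_bigr => p /eqP ->.
  under eq_bigr do rewrite mulg1 mulgV left_regular1.
  rewrite big_const_seq count_predT iter_addr_0 -scaler_nat scalerA.
  by rewrite /m rmorph_nat.
have XE : l2norm X <= m * (e * l2norm xi).
  apply: le_trans (l2norm_sum _ _ _) _.
  apply: (@le_trans _ _ (\sum_(h <- hs) e * l2norm xi)).
    apply: ler_sum => h _; rewrite l2norm_left_regular.
    by apply: le_trans (sT _) _; rewrite l2norm_left_regular.
  by rewrite big_const_seq count_predT iter_addr_0 mulr_natl.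
have YE : l2norm Y <= m * (e * l2norm xi).
  apply: le_trans (l2norm_sum _ _ _) _.
  apply: (@le_trans _ _ (\sum_(p <- s | p.2 != 1%g)
      nc p.1 * (e / K * m * l2norm xi))).
    rewrite big_seq_cond [leRHS]big_seq_cond; apply: ler_sum => p /andP[ps p1].
    rewrite l2norm_scale; apply: ler_wpM2l; first exact: normc_ge0.
    by apply: hsP; rewrite mem_filter p1 map_f.
  rewrite -mulr_suml (_ : m * _ = K * (e / K * m * l2norm xi)); last first.
    by field; rewrite gt_eqF.
  apply: ler_wpM2r.
    by rewrite !mulr_ge0 ?l2norm_ge0 ?invr_ge0// ltW.
  rewrite /K [X in _ <= 1 + X](bigID (fun p => p.2 == 1%g))/= addrA lerDr.
  by rewrite addr_ge0// sumr_ge0// => p _; exact: normc_ge0.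
have -> : ((m^-1)%:C *: \sum_(h <- hs) (lam h \o (T \o lam h^-1%g)) - id) xi =
   (m^-1)%:C *: X + ((m^-1)%:C *: Y + (c - 1) *: xi).
  rewrite !fctE fct_sumE/= E !scalerDr scalerA mulrA -rmorphM/= mulVf ?gt_eqF//.
  by rewrite mul1r scalerBl scale1r !addrA.
have nm : nc (m^-1)%:C = m^-1 by rewrite normc_real ger0_norm// invr_ge0 ltW.
have le (Z : l2 R H) : l2norm Z <= m * (e * l2norm xi) ->
    l2norm ((m^-1)%:C *: Z) <= e * l2norm xi.
  by rewrite l2norm_scale nm ler_pdivrMl.
apply: le_trans (l2normD _ _) _.
have := le X XE; have := le Y YE.
have := l2normD ((m^-1)%:C *: Y) ((c - 1) *: xi).
rewrite (l2norm_scale (c - 1)); have := ler_wpM2r (l2norm_ge0 xi) c1.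
lra.
Qed.

Lemma powers_averaging_cstar_simple : powers_averaging -> cstar_simple R H.
Proof.
move=> avg I idl; have [IA I0 IZ IM Icl] := idl.
have [[T [IT Tn0]]|noT] := pselect (exists T, I T /\ T != 0); last first.
  left; apply/seteqP; split=> [T IT|_ ->//].
  by apply: contrapT => T0; apply: noT; exists T; split=> //; exact/eqP.
right; suff Iid : I id.
  by apply/seteqP; split=> // S AS; have [] := IM S id AS Iid.
have [g Tg] : exists g, T (delta R 1%g) g != 0.
  apply: contrapT => /forallNP Tg; move/eqP: Tn0; apply.
  apply: cstar_r_delta_eq0; first exact: IA.
  by move=> g; apply/eqP/negPn/negP; exact: Tg.
(* Translation by [g^-1] moves the nonzero coefficient from [g] to 1, and rescaling makes it equal
   to 1. *)
pose T1 := (T (delta R 1%g) g)^-1 *: (lam g^-1%g \o T).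
have IT1 : I T1.
  apply: (closed_idealZ _ idl).
  by have [] := IM _ _ (left_regular_cstar_r R g^-1%g) IT.
have T11 : T1 (delta R 1%g) 1%g = 1.
  rewrite -[LHS]/((T (delta R 1%g) g)^-1 * T (delta R 1%g) (g^-1^-1 * 1)%g).
  by rewrite invgK mulg1 mulVf.
apply: Icl; split.
  by split=> [//|]; exists 1 => xi; rewrite mul1r.
(* The error [3 * (e / 4)] meets the strict inequality in [opclosure]. *)
move=> e e0; have e4 : 0 < e / 4 by rewrite divr_gt0.
have [hs [hs0 hsP]] := average_near_id avg (IA _ IT1) T11 e4.
exists (((size hs)%:R^-1)%:C *: \sum_(h <- hs) (lam h \o (T1 \o lam h^-1%g))).
  apply: (closed_idealZ _ idl); apply: (closed_ideal_sum _ idl) => h.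
  have [_ IT1h] := IM _ _ (left_regular_cstar_r R h^-1%g) IT1.
  by have [] := IM _ _ (left_regular_cstar_r R h) IT1h.
apply: (@le_lt_trans _ _ (3 * (e / 4))); last by lra.
apply: opnorm_le => [|xi]; first by lra.
apply: le_trans (hsP xi); rewrite -l2normN le_eqVlt; apply/orP; left; apply/eqP.
by congr l2norm; rewrite !fctE opprB.
Qed.

End powers_criterion.

(** * Membership in the full group through continuous sections *)

Section etale.

(** The part of being etale that makes the image of a continuous section of [src] open. *)
Definition src_locally_injective (G : topGroupoid) := forall g : G, exists2 W,
  nbhs g W & forall a b, W a -> W b -> src a = src b -> a = b.

(** The bisection is the image of [th]. It is open because an arrow [g] near [th x] and the arrow
    [th (src g)] both lie where [src] is injective, hence coincide. *)
Lemma full_group_section (G : topGroupoid) (h : homeo (unit_space G))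
    (th : unit_space G -> G) :
  compact [set: unit_space G] -> src_locally_injective G -> continuous th ->
  (forall x, src (th x) = x) -> (forall x, rng (th x) = h x) -> full_group h.
Proof.
move=> Gc Gi cth sth rth; exists (range th); split.
- exact: compact_img.
- rewrite openE => _ [x _ <-]; have [W nW Winj] := Gi (th x).
  have cts : continuous (th \o @src G).
    by move=> g; apply: continuous_comp; [exact: src_cts|exact: cth].
  have nW' : nbhs (th x) ((th \o @src G) @^-1` W) by apply: cts; rewrite /= sth.
  apply: filterS2 nW nW' => g Wg Wthg; exists (src g) => //.
  by apply: Winj => //; rewrite sth.
- exists th; split=> //; first exact/continuous_subspaceT/src_cts.
  by move=> _ [x _ <-]; rewrite sth.
- exists (th \o homeo_inv h); split.
  + exact/continuous_subspaceT/rng_cts.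
  + by move=> x; apply: continuous_comp; [exact: homeo_inv_cts|exact: cth].
  + by move=> x; exists (homeo_inv h x).
  + by move=> x /=; rewrite rth homeo_invK.
  + by move=> _ [x _ <-] /=; rewrite rth homeo_funK.
- by move=> _ [x _ <-]; rewrite sth rth.
Qed.

Lemma prod_src_locally_injective (G K : topGroupoid) :
  src_locally_injective G -> src_locally_injective K ->
  src_locally_injective (prod_groupoid G K).
Proof.
move=> Gi Ki [g h]; have [V nV Vi] := Gi g; have [W nW Wi] := Ki h.
exists (V `*` W); first by exists (V, W).
by move=> [a a'] [b b'] [/= Va Wa'] [/= Vb Wb'] [e e']; rewrite (Vi a b)// (Wi a' b').
Qed.

(** Since [I] is finite, neighbourhoods chosen in all coordinates define a neighbourhood for
    pointwise convergence. *)
Lemma pow_src_locally_injective (I : finType) (G : topGroupoid) :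
  src_locally_injective G -> src_locally_injective (pow_groupoid I G).
Proof.
move=> Gi g; have /choice[W Wi] : forall j, exists W : set G, nbhs (g j) W /\
    forall a b, W a -> W b -> src a = src b -> a = b.
  by move=> j; have [W] := Gi (g j); exists W.
exists [set a | forall j, W j (a j)].
  apply: (@filter_forall _ _ (fun j => [set a : {ptws I -> G} | W j (a j)]) _
    (@nbhs_filter {ptws I -> G} g)) => j.
  by apply: (@ptws_nbhs I G g j (W j)); have [] := Wi j.
move=> a b Wa Wb ab; apply/funext => j; have [_] := Wi j; apply => //.
exact: (congr1 (@^~ j) ab).
Qed.

Lemma full_relation_src_locally_injective r :
  src_locally_injective (full_relation r).
Proof.
move=> g; exists [set g]; last by move=> a b -> ->.
exact: (@discrete_set1 (discrete_topology ('I_r * 'I_r)%type)).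
Qed.

Lemma cuntz_src_locally_injective k :
  src_locally_injective (cuntz_groupoid k).
Proof.
move=> g; have /asboolP[p [q [gpq e]]] := cuntz_valP g.
have [mu [nu [z [_ _ gE]]]] := cuntz_at 0 gpq e.
exists (cuntz_basic mu nu setT).
  by apply: cuntz_basic_nbhs; [exact: openT|exists z].
move=> a b [x _ aE] [y _ bE]; rewrite /= /cuntz_src aE bE /=.
by move=> /wcat_inj[//|_ xy]; apply: val_inj; rewrite /= aE bE xy.
Qed.

(** A basic neighbourhood of [t z0] may have longer prefixes than [mu'] and [nu']. Both are
    therefore extended by the first [size mu] letters of [w z], which are locally constant in
    [z]. *)
Lemma cuntz_continuous k (Z : topologicalType) (t : Z -> cuntz_arrow k) :
  (forall z0 : Z, exists mu nu (w : Z -> seqspace k), continuous w /\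
    \forall z \near z0, cuntz_val (t z) =
      (wcat mu (w z), ((size mu)%:Z - (size nu)%:Z)%R, wcat nu (w z))) ->
  continuous t.
Proof.
move=> tw z0 W /cuntz_nbhs[mu [nu [U [oU t0U sub]]]].
have [mu' [nu' [w [wc nw]]]] := tw z0; set c := size mu.
pose be z := mkseq (w z) c; pose v z := iter c (@seq_shift k) (w z).
have vc : continuous v.
  by move=> z; apply: continuous_comp; [exact: wc|exact: iter_seq_shift_cts].
have tE z : cuntz_val (t z) =
      (wcat mu' (w z), ((size mu')%:Z - (size nu')%:Z)%R, wcat nu' (w z)) ->
    be z = be z0 -> cuntz_val (t z) = (wcat (mu' ++ be z0) (v z),
      ((size (mu' ++ be z0))%:Z - (size (nu' ++ be z0))%:Z)%R,
      wcat (nu' ++ be z0) (v z)).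
  move=> -> bez; rewrite !wcat_cat -bez wcat_take !size_cat.
  by congr (_, _, _); lia.
have [|al [muE nuE Ual]] := cuntz_refine t0U (tE z0 (nbhs_singleton nw) erefl).
  by rewrite size_cat size_mkseq; lia.
have nbe : \forall z \near z0, be z = be z0.
  apply: (wc z0 [set x | mkseq x c = be z0]).
  rewrite -[c in [set _ | mkseq _ c = _]](size_mkseq (w z0) c).
  by apply: open_nbhs_nbhs; split; [exact: cylinder_open|rewrite /= size_mkseq].
have nU : \forall z \near z0, U (wcat al (v z)).
  have cav : continuous (wcat al \o v).
    by move=> z; apply: continuous_comp; [exact: vc|exact: wcat_cts].
  by apply: (cav z0 U); apply: open_nbhs_nbhs.
change (nbhs z0 (t @^-1` W)).
apply: filterS3 nw nbe nU => z nwz bez Uz; apply: sub; exists (wcat al (v z)) => //.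
rewrite tE// muE nuE !wcat_cat !size_cat; congr (_, _, _); lia.
Qed.

End etale.

(** * The ping-pong involutions on a single sequence *)

Section word_swap.
Context (k : nat) (a : seq 'I_k).
Local Notation L := (size a).
Local Notation shift := (@seq_shift k).
Implicit Types (y z : seqspace k).

(* The involution exchanging b z and a b z for every word b <> a of length |a|;
   it maps the complement of the cylinder of a into that cylinder. *)
Definition word_swap z : seqspace k :=
  if mkseq z L != a then wcat a z
  else if mkseq (iter L shift z) L != a then iter L shift z else z.

(** The integer component of the arrow from [z] to [word_swap z]: the length of the prefix added
    minus that of the prefix removed. *)
Definition word_swap_degree z : int :=
  (if mkseq z L != a then L%:Z
   else if mkseq (iter L shift z) L != a then - L%:Z else 0)%R.

Lemma word_swapK : involutive word_swap.
Proof.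
move=> z; rewrite {2}/word_swap; have [za|za] := eqVneq (mkseq z L) a; last first.
  by rewrite /word_swap take_wcat eqxx shift_wcat /= za.
have [za'|za'] := eqVneq (mkseq (iter L shift z) L) a.
  by rewrite /word_swap za za' eqxx.
by rewrite /word_swap za' /= -{1}za wcat_take.
Qed.

Lemma word_swap_ping z : mkseq z L != a -> mkseq (word_swap z) L = a.
Proof. by move=> za; rewrite /word_swap za take_wcat. Qed.

Lemma mkseq_nbhs n z : nbhs z [set y : seqspace k | mkseq y n = mkseq z n].
Proof.
have := cylinder_open (mkseq z n); rewrite size_mkseq => o.
by apply: open_nbhs_nbhs; split.
Qed.

(** The case distinction reads at most the first [2 * size a] letters, so locally one fixed prefix
    is replaced by another: the empty word by [a], [a] by the empty word, or the empty word by
    itself. *)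
Lemma word_swap_local (z0 : seqspace k) : exists mu nu : seq 'I_k, \forall z \near z0,
  [/\ z = wcat nu (iter (size nu) shift z),
      word_swap z = wcat mu (iter (size nu) shift z) &
      word_swap_degree z = ((size mu)%:Z - (size nu)%:Z)%R].
Proof.
have n0 := mkseq_nbhs L z0.
have n1 : \forall z \near z0, mkseq (iter L shift z) L = mkseq (iter L shift z0) L.
  exact: (@iter_seq_shift_cts k L z0 _ (mkseq_nbhs L (iter L shift z0))).
have w0 (z : seqspace k) : wcat [::] z = z.
  by apply/funext => n; rewrite /wcat nth_nil subn0.
have [za|za] := eqVneq (mkseq z0 L) a; last first.
  exists a, [::]; apply: filterS n0 => z /= ze.
  by rewrite /word_swap /word_swap_degree ze za w0 /= subr0.
have [za'|za'] := eqVneq (mkseq (iter L shift z0) L) a.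
  exists [::], [::]; apply: filterS2 n0 n1 => z /= ze ze'.
  by rewrite /word_swap /word_swap_degree ze ze' za za' eqxx /= w0 subr0.
exists [::], a; apply: filterS2 n0 n1 => z /= ze ze'.
rewrite /word_swap /word_swap_degree ze ze' za za' eqxx /= w0 sub0r; split=> //.
by rewrite -{1}za -ze wcat_take.
Qed.

(** Acting below the first [d] letters preserves every cylinder of depth [d]. *)
Definition deep_swap d y : seqspace k :=
  wcat (mkseq y d) (word_swap (iter d shift y)).

Lemma mkseq_deep_swap d y : mkseq (deep_swap d y) d = mkseq y d.
Proof. by rewrite -[X in mkseq _ X = _](size_mkseq y d) take_wcat. Qed.

Lemma shift_deep_swap d y :
  iter d shift (deep_swap d y) = word_swap (iter d shift y).
Proof. by rewrite -[X in iter X](size_mkseq y d) shift_wcat size_mkseq. Qed.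

Lemma deep_swapK d : involutive (deep_swap d).
Proof.
move=> y; rewrite {1}/deep_swap mkseq_deep_swap shift_deep_swap word_swapK.
exact: wcat_take.
Qed.

Lemma deep_swap_local d (y0 : seqspace k) : exists mu nu : seq 'I_k, \forall y \near y0,
  [/\ y = wcat nu (iter (size nu) shift y),
      deep_swap d y = wcat mu (iter (size nu) shift y) &
      word_swap_degree (iter d shift y) = ((size mu)%:Z - (size nu)%:Z)%R].
Proof.
have [mu [nu nE]] := word_swap_local (iter d shift y0).
exists (mkseq y0 d ++ mu), (mkseq y0 d ++ nu).
have n0 := mkseq_nbhs d y0.
have n1 := @iter_seq_shift_cts k d y0 _ nE.
apply: filterS2 n0 n1 => y /= ye [e1 e2 e3].
rewrite !size_cat size_mkseq -ye !wcat_cat addnC iterD; split.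
- by rewrite -e1 wcat_take.
- by rewrite -e2.
- by rewrite e3; lia.
Qed.

End word_swap.

(** * Boxes in the unit space *)

Section bht_space.
Context (n r k : nat).
Local Notation X := (unit_space (bht_groupoid n k r)).
Implicit Types p q : X.

Definition tile p : discrete_topology 'I_r := p.1.
Definition coord p (j : 'I_n) : seqspace k := p.2 j.
Definition point (i : 'I_r) (y : 'I_n -> seqspace k) : X := (i, y).

Lemma coord_cts j : continuous (coord ^~ j).
Proof.
move=> p; apply: (@continuous_comp X {ptws 'I_n -> seqspace k} (seqspace k)
  snd (fun y => y j)); first exact: cvg_snd.
by move=> U; exact: (@ptws_nbhs 'I_n (seqspace k) p.2 j U).
Qed.

(** For fixed [d] this is an equivalence relation, so boxes of depth [d] partition the space; over
    all [d] they form a neighbourhood base ([box_nbhs], [nbhs_box]). *)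
Definition box (d : nat) p : set X := [set q | tile q = tile p /\
  forall j, mkseq (coord q j) d = mkseq (coord p j) d].

Lemma box_sym d p q : box d p q -> box d q p.
Proof. by move=> [e1 e2]; split=> // j; rewrite e2. Qed.
Lemma box_trans d q p s : box d p q -> box d q s -> box d p s.
Proof. by move=> [e1 e2] [e3 e4]; split=> [|j]; rewrite ?e3// e4. Qed.

Lemma box_le d d' p : (d <= d')%N -> box d' p `<=` box d p.
Proof.
move=> dd q [e1 e2]; split=> // j.
have tk (y : seqspace k) : mkseq y d = take d (mkseq y d').
  by rewrite /mkseq -map_take take_iota (minn_idPl dd).
by rewrite !tk e2.
Qed.

Lemma box_nbhs d p : nbhs p (box d p).
Proof.
have n1 : nbhs p [set q : X | tile q = tile p].
  exact: (@cvg_fst _ _ (nbhs p.1) (nbhs p.2) _ [set x | x = tile p] (discrete_set1 _)).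
have n2 : nbhs p [set q : X | forall j, mkseq (coord q j) d = mkseq (coord p j) d].
  apply: (@filter_forall _ _ (fun j => [set q : X | mkseq (coord q j) d =
    mkseq (coord p j) d]) _ (@nbhs_filter X p)) => j.
  exact: (coord_cts (mkseq_nbhs d (coord p j))).
by apply: filterS2 n1 n2 => q; split.
Qed.

Lemma box_sep p q : p <> q -> exists d, ~ box d p q.
Proof.
move=> pq; apply: contrapT => /forallNP H; apply: pq.
have {}H d : box d p q by exact: contrapT.
have [e _] := H 0%N; move: e H; case: p q => [i y] [i' y'] /= e H.
rewrite /tile/= in e; rewrite e; congr (_, _); apply/funext => j; apply/funext => m.
have [_ /(_ j)] := H m.+1; rewrite /coord !mkseqS /= => /rcons_inj[_ ].
by move=> ->.
Qed.

(** The boxes around [p] generate a filter converging to [p]: convergence is tested letter by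
    letter, and depth [m.+1] fixes letter [m] of every coordinate. *)
Lemma nbhs_box p (U : set X) : nbhs p U -> exists d, box d p `<=` U.
Proof.
pose F := filter_from [set: nat] (box ^~ p).
have FF : Filter F.
  apply: filter_from_filter; first by exists 0%N.
  move=> i j _ _; exists (maxn i j) => // q bq.
  by split; apply: box_le bq; rewrite ?leq_maxl ?leq_maxr.
suff : F --> p by move=> FU /FU[d _ dU]; exists d.
move=> V [[V1 V2] /= [V1p V2p] sub].
have F1 : F [set q | V1 q.1].
  move: V1p => /nbhs_singleton V1p; exists 0%N => // q [e _].
  by rewrite /tile in e; rewrite /= e.
have F2 : snd @ F --> (p.2 : {ptws 'I_n -> seqspace k}).
  apply: (@ptws_cvgP 'I_n (seqspace k)) => j.
  apply: (@ptws_cvgP nat (discrete_topology 'I_k) ((fun q : X => q.2 j) @ F)) => m W.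
  move=> /nbhs_singleton Wp; exists m.+1 => // q [_ /(_ j)].
  by rewrite /coord !mkseqS => /rcons_inj[_]; rewrite /= => ->.
by apply: filterS2 F1 (F2 _ V2p) => -[q1 q2] /= Vq1 Vq2; exact: sub.
Qed.

End bht_space.

(** * Involutions of the full group supported on a union [S] of boxes of depth [d] *)

Section box_swap.
Context (n r k : nat) (i0 : 'I_n) (d : nat) (a : seq 'I_k).
Local Notation X := (unit_space (bht_groupoid n k r)).
Context (S : set X).
Hypothesis Sbox : forall p q : X, box d p q -> S p -> S q.
Implicit Types p q : X.

Definition swapped p j : bool := `[< S p >] && (j == i0).

Definition box_swap_fun p : X := point (tile p)
  (fun j => if swapped p j then deep_swap a d (coord p j) else coord p j).

Lemma box_swap_fun_box p : box d p (box_swap_fun p).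
Proof.
split=> // j; rewrite [coord (box_swap_fun p) j]/coord /=.
by case: ifP => // _; exact: mkseq_deep_swap.
Qed.

Lemma swapped_box_swap p j : swapped (box_swap_fun p) j = swapped p j.
Proof.
congr (_ && _); apply/asboolP/asboolP; apply: Sbox.
  exact/box_sym/box_swap_fun_box.
exact: box_swap_fun_box.
Qed.

Lemma coord_box_swap p j : coord (box_swap_fun p) j =
  if swapped p j then deep_swap a d (coord p j) else coord p j.
Proof. by []. Qed.

Lemma box_swap_fun_out p : ~ S p -> box_swap_fun p = p.
Proof.
move=> nSp; rewrite [RHS]surjective_pairing; congr (_, _); apply/funext => j.
by rewrite /swapped asboolF.
Qed.

Lemma box_swap_fun_in p : S p ->
  coord (box_swap_fun p) i0 = deep_swap a d (coord p i0).
Proof. by move=> Sp; rewrite coord_box_swap /swapped asboolT// eqxx. Qed.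

Lemma box_swap_funK : involutive box_swap_fun.
Proof.
move=> p; rewrite {1}/box_swap_fun [RHS]surjective_pairing.
congr (_, _); apply/funext => j; rewrite swapped_box_swap coord_box_swap.
by case: (swapped p j) => //; exact: deep_swapK.
Qed.

Definition swap_degree p j : int :=
  (if swapped p j then word_swap_degree a (iter d (@seq_shift k) (coord p j)) else 0)%R.

(** This is the form that [cuntz_continuous] requires. Since [S] is a union of boxes, [swapped] is
    locally constant; where it is false the arrow is a unit, described by empty prefixes. *)
Lemma box_swap_local j (p0 : X) : exists mu nu (w : X -> seqspace k), continuous w /\
  \forall p \near p0, (coord (box_swap_fun p) j, swap_degree p j, coord p j) =
    (wcat mu (w p), ((size mu)%:Z - (size nu)%:Z)%R, wcat nu (w p)).
Proof.
have nS : \forall p \near p0, swapped p j = swapped p0 j.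
  apply: filterS (box_nbhs d p0) => p bp; congr (_ && _).
  by apply/asboolP/asboolP; apply: Sbox => //; exact: box_sym.
case sp0 : (swapped p0 j) nS => nS; last first.
  exists [::], [::], (fun p => coord p j); split; first exact: coord_cts.
  apply: filterS nS => p sp; rewrite coord_box_swap /swap_degree sp /= subrr.
  by congr (_, _, _); apply/funext => m; rewrite /wcat nth_nil subn0.
have [mu [nu nE]] := deep_swap_local a d (coord p0 j).
exists mu, nu, (fun p => iter (size nu) (@seq_shift k) (coord p j)); split.
  move=> p; apply: (continuous_comp (coord_cts (j := j) (x := p))).
  exact: iter_seq_shift_cts.
have nE' := coord_cts (j := j) (x := p0) nE.
apply: filterS2 nS nE' => p sp [e1 e2 e3].
by rewrite coord_box_swap /swap_degree sp -e1 -e2 e3.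
Qed.

Lemma swap_arrow_subproof p j :
  `[< cuntz_rel (coord (box_swap_fun p) j, swap_degree p j, coord p j) >].
Proof.
have [mu [nu [w [_ /nbhs_singleton ->]]]] := box_swap_local j p.
by apply/asboolP; exists (size mu), (size nu); rewrite !shift_wcat.
Qed.

(** The arrow from [p] to [box_swap_fun p]; its component in the finite relation is a unit, because
    tiles do not move. *)
Definition box_swap_section p : bht_groupoid n k r :=
  ((tile p, tile p), fun j => CuntzArrow (swap_arrow_subproof p j)).

Lemma box_swap_section_cts : continuous box_swap_section.
Proof.
move=> p U [[U1 U2] /= [nU1 nU2] UU].
have c1 : nbhs p [set q : X | U1 (tile q, tile q)].
  apply: filterS (box_nbhs 0 p) => q [e _]; rewrite /= e.
  exact: nbhs_singleton nU1.
have c2 : nbhs p [set q : X | U2 (fun j => CuntzArrow (swap_arrow_subproof q j))].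
  apply: (@ptws_continuous X 'I_n (cuntz_arrow k)
    (fun q j => CuntzArrow (swap_arrow_subproof q j)) _ p U2 nU2) => x j V nV.
  apply: (@cuntz_continuous k X (fun q => CuntzArrow (swap_arrow_subproof q j)) _
    x V nV).
  exact: box_swap_local.
by apply: filterS2 c1 c2 => q U1q U2q; apply: UU.
Qed.

Lemma box_swap_fun_cts : continuous box_swap_fun.
Proof.
move=> p; apply: (@continuous_comp X (bht_groupoid n k r) X box_swap_section rng).
  exact: box_swap_section_cts.
exact: rng_cts.
Qed.

Definition box_swap_homeo : homeo X := Homeo box_swap_funK box_swap_funK
  box_swap_fun_cts box_swap_fun_cts.

Lemma box_swap_full : box_swap_homeo \in @in_full_group (bht_groupoid n k r).
Proof.
apply/asboolP; apply: (full_group_section (th := box_swap_section)).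
- exact: bht_unit_compact.
- apply: prod_src_locally_injective; first exact: full_relation_src_locally_injective.
  by apply: pow_src_locally_injective; exact: cuntz_src_locally_injective.
- exact: box_swap_section_cts.
- by move=> p; rewrite [RHS]surjective_pairing.
- by [].
Qed.

Definition box_swap : brin_higman_thompson n k r := FullGroup _ _ box_swap_full.

End box_swap.

(** * Choice of the points and of the depth *)

Section point_selection.
Context (n r k : nat) (i0 : 'I_n) (hk : (2 <= k)%N).
Local Notation X := (unit_space (bht_groupoid n k r)).
Local Notation H := (brin_higman_thompson n k r).
Implicit Types (p q : X) (f g : H).

Lemma bhtM f g p : (f * g)%g p = f (g p). Proof. by []. Qed.

Lemma bhtKV f p : f (f^-1%g p) = p.
Proof. by rewrite -bhtM mulgV. Qed.

Lemma bhtVK f p : f^-1%g (f p) = p.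
Proof. by rewrite -bhtM mulVg. Qed.

Lemma bht_moves f : f != 1%g -> exists p, f p <> p.
Proof.
move=> f1; apply: contrapT => /forallNP H; move/eqP: f1; apply.
by apply: val_inj; apply: homeo_eq => p; have /contrapT := H p.
Qed.

(** Depth [d1] separates [q] from [f p], and continuity of [f] at [p] gives [d2]. Validity at all
    larger depths lets finitely many pairs share one depth. *)
Lemma box_image_separated f p q : f p <> q -> exists d, forall d', (d <= d')%N ->
  forall s, box d' p s -> ~ box d' q (f s).
Proof.
move=> /nesym/box_sep[d1 nb].
have : nbhs p (f @^-1` box d1 (f p)).
  by apply: (@homeo_fun_cts X f); exact: box_nbhs.
move=> /nbhs_box[d2 sub]; exists (maxn d1 d2) => d'; rewrite geq_max => /andP[l1 l2].
move=> s /(box_le l2)/sub fs /(box_le l1) qs; apply: nb.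
exact: box_trans qs (box_sym fs).
Qed.

Definition other_letter (x : 'I_k) : 'I_k :=
  if val x == 0%N then Ordinal hk else Ordinal (ltnW hk).

Lemma other_letter_neq x : other_letter x != x.
Proof.
rewrite -val_eqE /other_letter; case: ifP => /= [/eqP->//|/negbT].
by rewrite eq_sym.
Qed.

Definition flip (p : X) (m : nat) : X := point (tile p) (fun j =>
  if j == i0 then fun i => if i == m then other_letter (coord p j i) else coord p j i
  else coord p j).

Lemma flip_box d m p : (d <= m)%N -> box d p (flip p m).
Proof.
move=> dm; split=> // j; apply/eq_in_map => i; rewrite mem_iota add0n => /= id.
rewrite /coord /=; case: ifP => // _; rewrite ifF//.
by apply/negbTE; rewrite neq_ltn (leq_trans id dm).
Qed.

Lemma flip_inj p : injective (flip p).
Proof.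
move=> m m' e; apply/eqP/negPn/negP => mm.
have := congr1 (fun q : X => coord q i0 m) e.
rewrite /coord /= eqxx eqxx (negbTE mm) => e'.
by have := other_letter_neq (coord p i0 m); rewrite /coord e' eqxx.
Qed.

(** A whole box around a moved point consists of moved points, and it contains the pairwise distinct
    points [flip p m] for [m >= d]; among [(size bad).+1] of them, one avoids [bad]. *)
Lemma moved_point_notin f (bad : seq X) : f != 1%g ->
  exists p, f p <> p /\ p \notin bad.
Proof.
move=> /bht_moves[p /box_image_separated[d sep]].
suff [m dm mb] : exists2 m, (d <= m)%N & flip p m \notin bad.
  exists (flip p m); split=> // fq; have bm := flip_box p dm.
  by have := sep d (leqnn d) _ bm; rewrite fq.
apply: contrapT => none.
have : (size [seq flip p m | m <- iota d (size bad).+1] <= size bad)%N.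
  apply: uniq_leq_size; first by rewrite (map_inj_uniq (@flip_inj p)) iota_uniq.
  move=> _ /mapP[m /[!mem_iota] /andP[dm _] ->]; apply/negPn/negP => mb.
  by apply: none; exists m.
by rewrite size_map size_iota ltnn.
Qed.

(** By induction on [F]. The point [y] chosen for a new [g] must satisfy [g y <> y], [y <> g (x f)]
    and [y <> f^-1 (x f)] for the earlier [f]: it is moved by [g] and avoids a finite list. *)
Lemma generic_points (p0 : X) (F : seq H) : 1%g \notin F ->
  exists x : H -> X, forall f f', f \in F -> f' \in F -> f (x f') <> x f.
Proof.
elim: F => [|g F IH]; first by exists (fun=> p0).
rewrite inE negb_or eq_sym => /andP[g1 /IH[x xF]].
have [gF|gF] := boolP (g \in F).
  have sub f : (f \in g :: F) = (f \in F) by rewrite inE; case: eqP => // ->.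
  by exists x => f f'; rewrite !sub; exact: xF.
have [y [gy]] := moved_point_notin
  ([seq g (x f) | f <- F] ++ [seq f^-1%g (x f) | f <- F] : seq X) g1.
rewrite mem_cat negb_or => /andP[/mapP y1 /mapP y2].
have neq f : f \in F -> (f == g) = false.
  by move=> fF; apply: contraNF gF => /eqP <-.
exists (fun f => if f == g then y else x f) => f f'.
rewrite !inE => /orP[/eqP->|fF] /orP[/eqP->|f'F]; rewrite ?eqxx ?neq//.
- by move=> e; apply: y1; exists f'.
- by move=> e; apply: y2; exists f => //; rewrite -e bhtVK.
- exact: xF.
Qed.

Lemma eventually_all (T : eqType) (s : seq T) (P : T -> nat -> Prop) :
  (forall t, t \in s -> exists d, forall d', (d <= d')%N -> P t d') ->
  exists d, forall t, t \in s -> forall d', (d <= d')%N -> P t d'.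
Proof.
elim: s => [|u s IH] H; first by exists 0%N.
have [d1 H1] := H u (mem_head _ _).
have [|d2 H2] := IH; first by move=> t ts; apply: H; rewrite inE ts orbT.
exists (maxn d1 d2) => t; rewrite inE => /orP[/eqP->|ts] d'; rewrite geq_max => /andP[l1 l2].
  exact: H1.
exact: H2 ts _ l2.
Qed.

Lemma generic_boxes (p0 : X) (F : seq H) : 1%g \notin F ->
  exists (x : H -> X) (d : nat), forall f f', f \in F -> f' \in F ->
    forall s, box d (x f') s -> ~ box d (x f) (f s).
Proof.
move=> /(generic_points p0)[x xF]; exists x.
have [|d dP] := @eventually_all _ [seq (f, f') | f <- F, f' <- F]
  (fun u d => forall s, box d (x u.2) s -> ~ box d (x u.1) (u.1 s)).
  move=> _ /allpairsP[[f f'] [/= fF f'F ->]]; apply: box_image_separated.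
  exact: xF.
exists d => f f' fF f'F; apply: (dP (f, f')) => //.
by apply/allpairsP; exists (f, f').
Qed.

End point_selection.

(** * Ping-pong for commutators in an abstract action *)

Section commutator_pingpong.
Context (R : realType) (H : groupType) (X : choiceType) (act : H -> X -> X).
Hypothesis actM : forall g h p, act (g * h)%g p = act g (act h p).
Hypothesis act1 : forall p, act 1%g p = p.
Context (A : finType) (u : A -> H) (f : H) (Y : set X) (label : X -> A).
Hypothesis Y0 : exists p, Y p.
Hypothesis uY : forall a p, Y (act (u a) p) <-> Y p.
Hypothesis uf : forall a p, Y p -> act (u a) (act f^-1%g p) = act f^-1%g p.
Hypothesis ulabel : forall a p, Y p -> label p != a -> label (act (u a) p) = a.

Let actVK g p : act g^-1%g (act g p) = p.
Proof. by rewrite -actM mulVg act1. Qed.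

Let actKV g p : act g (act g^-1%g p) = p.
Proof. by rewrite -actM mulgV act1. Qed.

Let w a := (u a * f * (u a)^-1 * f^-1)%g.

(* u a is the identity on f^-1 Y, so the commutator w a acts on Y as u a. *)
Let wE a p : Y p -> act (w a) p = act (u a) p.
Proof.
move=> Yp; rewrite /w !actM; congr act.
by rewrite -{1}(uf a Yp) actVK actKV.
Qed.

Let wY a p : Y (act (w a) p) <-> Y p.
Proof.
split=> [Yw|Yp]; last by rewrite wE// uY.
(* On this point of [Y] the maps [w a] and [u a] agree, so [w a] sends it to [act (w a) p]; by
   injectivity it is [p]. *)
have Yv : Y (act (u a)^-1%g (act (w a) p)) by rewrite -(uY a) actKV.
by rewrite -(actVK (w a) p) -{1}(actKV (u a) (act (w a) p)) -wE// actVK.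
Qed.

(* The base point of g is a choice among the points that g sends to Y, hence
   depends only on the coset of g by the stabilizer of Y. *)
Lemma commutator_pingpong : bounded_by (2 * Num.sqrt #|A|%:R)
  (fun xi : l2 R H => \sum_a left_regular (u a * f * (u a)^-1)%g xi).
Proof.
have [p0 Yp0] := Y0.
pose y g := xget p0 [set p | Y (act g p)].
have yY g : Y (act g (y g)).
  apply: (@xgetPex _ p0 [set p | Y (act g p)]).
  by exists (act g^-1%g p0); rewrite /= actKV.
have yw a g : y (w a * g)%g = y g.
  by congr xget; apply/funext => p; apply/propext; rewrite /= actM; exact: wY.
have ping a g : label (act g (y g)) != a ->
    label (act (w a * g)%g (y (w a * g)%g)) = a.
  by move=> ga; rewrite yw actM wE// ulabel.
(* Since [w a * f] is the conjugate of [f] by [u a], the estimate is applied to the translate of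
   [xi] by [f], which has the same norm. *)
move=> xi; have := pingpong_norm (R := R) ping (left_regular f xi).
rewrite l2norm_left_regular; apply: le_trans.
rewrite le_eqVlt; apply/orP; left; apply/eqP; congr l2norm; apply: eq_bigr => a _.
by rewrite -left_regularM /w mulgVK.
Qed.

End commutator_pingpong.

(** * The averaging property of the Brin-Higman-Thompson groups *)

Section averaging.
Context (R : realType) (n r k : nat) (i0 : 'I_n) (hk : (2 <= k)%N).
Local Notation X := (unit_space (bht_groupoid n k r)).
Local Notation H := (brin_higman_thompson n k r).
Implicit Types (p q : X) (f g : H).

(** After squaring, [4 / e ^+ 2 <= k ^ L] suffices; [L] is taken above [4 / e ^+ 2], and
    [L < k ^ L]. *)
Lemma exists_word_length (e : R) : 0 < e ->
  exists L, 2 * Num.sqrt (k ^ L)%:R <= e * (k ^ L)%:R.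
Proof.
move=> e0; pose L := Num.bound (4 / e ^+ 2).
have e2 : 0 < e ^+ 2 by rewrite exprn_gt0.
have kL : 4 / e ^+ 2 <= (k ^ L)%:R.
  apply: (@le_trans _ _ L%:R).
    by apply/ltW/archi_boundP; rewrite divr_ge0// ltW.
  by rewrite ler_nat ltnW// ltn_expl.
exists L; set m : R := (k ^ L)%:R in kL *.
have m0 : 0 <= m by exact: ler0n.
rewrite -(@ler_pXn2r _ 2)// ?nnegrE ?mulr_ge0 ?sqrtr_ge0 ?(ltW e0)//.
rewrite !exprMn sqr_sqrtr// [_ ^+ 2 * m]mulrC.
rewrite ler_pdivrMr// in kL.
by have := ler_wpM2l m0 kL; lra.
Qed.

Lemma bht_powers_averaging (p0 : X) : powers_averaging R H.
Proof.
move=> F e e0 F1; have [x [d xd]] := generic_boxes i0 hk p0 F1.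
(* A single support for all of [F], so that the same involutions serve every [f]. *)
pose S : set X := [set q | exists2 f, f \in F & box d (x f) q].
have Sbox p q : box d p q -> S p -> S q.
  by move=> pq [f fF fp]; exists f => //; exact: box_trans fp pq.
have [L Le] := exists_word_length e0.
pose u (a : L.-tuple 'I_k) : H := box_swap i0 a Sbox.
have cardA : #|{: L.-tuple 'I_k}| = (k ^ L)%N by rewrite card_tuple card_ord.
exists [seq u a | a <- enum {: L.-tuple 'I_k}]; split.
  by rewrite -size_eq0 size_map -cardE cardA expn_eq0; case: (k) hk.
move=> f fF xi; rewrite size_map -cardE cardA big_map big_enum /=.
apply: le_trans (ler_wpM2r (l2norm_ge0 xi) Le).
rewrite -cardA.
(* The label is the window of [L] letters, after the first [d], on which the swaps act. *)
pose label p : L.-tuple 'I_k :=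
  [tuple iter d (@seq_shift k) (coord p i0) i | i < L].
have labelE p : val (label p) = mkseq (iter d (@seq_shift k) (coord p i0)) L.
  by rewrite /= /mkseq -val_enum_ord -map_comp.
apply: (@commutator_pingpong R H X (fun g p => g p) _ _ _ u f (box d (x f)) label).
- by [].
- by [].
- by exists (x f).
- move=> a p; have up : box d p (u a p) by exact: box_swap_fun_box.
  by split=> b; apply: box_trans b _ => //; exact: box_sym.
(* The preimage under [f] of the box around [x f] misses [S], by the choice of [d]. *)
- move=> a p bp; apply: box_swap_fun_out => -[f' f'F b].
  by apply: (xd f f' fF f'F _ b); rewrite bhtKV.
- move=> a p bp ka; apply: val_inj; rewrite labelE.
  rewrite [coord _ _]box_swap_fun_in; last by exists f.
  rewrite shift_deep_swap.
  have := @word_swap_ping k (val a) (iter d (@seq_shift k) (coord p i0)).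
  by rewrite size_tuple -labelE val_eqE; exact.
Qed.

End averaging.

Theorem mainTheorem7 (R : realType) (n r k : nat)
    (hn : (1 <= n)%N) (hr : (1 <= r)%N) (hk : (2 <= k)%N) :
  cstar_simple R (brin_higman_thompson n k r).
Proof.
apply: powers_averaging_cstar_simple.
(* The swaps act on the coordinate given by [hn]; the base point starts the inductive choice of
   points. *)
exact (bht_powers_averaging (Ordinal hn) hk
  (point (Ordinal hr) (fun=> (fun=> Ordinal hk)))).
Qed.
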